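(* Fix an integer $b\ge2$ and $\gamma\in(0,1)$, and let $\phi:\mathbb{R}\to\mathbb{R}$ be a $\mathbb{Z}$-periodic Lipschitz function satisfying condition (H). Let $\alpha\in[0,1]$ be the constant such that $m_x$ is exact dimensional with $\dim(m_x)=\alpha$ for Lebesgue-a.e. $x\in[0,1]$. Then for any $\varepsilon>0$ there is $M_1(\varepsilon)$, for any $m\ge M_1(\varepsilon)$ there is $K_1(\varepsilon,m)$, and for any $k\ge K_1(\varepsilon,m)$ there is $N_1(\varepsilon,m,k)$ such that for every $n\ge N_1(\varepsilon,m,k)$, $$\nu^n\big(\{\mathbf{i}\in\Lambda^n:\ m_{\mathbf{i}(0)}\text{ is }(\alpha,\varepsilon,m)\text{-entropy porous from scale }1\text{ to }k\}\big)>1-\varepsilon.$$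
   Context: $\Lambda=\{0,\dots,b-1\}$, $\Sigma=\Lambda^{\mathbb{Z}_+}$, $\nu$ uniform on $\Lambda$. $S(x,\mathbf{j})=\sum_{n\ge1}\gamma^{n-1}\phi\big(\frac{x+j_1+j_2b+\cdots+j_nb^{n-1}}{b^n}\big)$ for $\mathbf{j}\in\Sigma$, $x\in[0,1]$; condition (H): for all $\mathbf{i}\neq\mathbf{j}\in\Sigma$, $x\mapsto S(x,\mathbf{j})-S(x,\mathbf{i})$ is not identically zero. $m_x$ is the image of $\nu^{\mathbb{Z}_+}$ under $\mathbf{j}\mapsto S(x,\mathbf{j})$ (the existence of $\alpha$ is known). For $\mathbf{i}\in\Lambda^n$ and $x\in[0,1]$, $\mathbf{i}(x)=\frac{x+i_1+i_2b+\cdots+i_nb^{n-1}}{b^n}$. $\mathcal{L}_n$ is the partition of $\mathbb{R}$ into intervals $[j/b^n,(j+1)/b^n)$, $j\in\mathbb{Z}$; $H(\mu,\mathcal{Q})=-\sum_{Q\in\mathcal{Q}}\mu(Q)\log_b\mu(Q)$. For $\mu$ a probability on $\mathbb{R}$, $\mu_{x,i}$ is $\mu$ restricted to the $\mathcal{L}_i$-interval containing $x$ and normalized. $\mu$ is $(h,\delta,m)$-entropy porous from scale $n_1$ to $n_2$ if $\frac{1}{n_2-n_1+1}\sum_{i=n_1}^{n_2}\mu\big(\{x:\frac1mH(\mu_{x,i},\mathcal{L}_{i+m})<h+\delta\}\big)>1-\delta$. *)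

(* Defs.v *)
From HB Require Import structures.
From mathcomp Require Import all_boot all_order all_algebra.
From mathcomp Require Import all_classical all_reals all_analysis.
Set Implicit Arguments. Unset Strict Implicit. Unset Printing Implicit Defensive.
Import Order.TTheory GRing.Theory Num.Theory.
Import numFieldNormedType.Exports.
Local Open Scope classical_set_scope.
Local Open Scope ring_scope.

Section Defs.
Variable R : realType.

(* Elements of Sigma = Lambda^{Z_+} are coded as j : nat -> nat with values < b;
   the paper's j_n (n >= 1) is (j n.-1). *)
Definition in_Sigma (b : nat) (j : nat -> nat) : Prop := forall n, (j n < b)%N.

Definition S_fun (b : nat) (gamma : R) (phi : R -> R) (x : R) (j : nat -> nat) : R :=
  limn (series (fun n : nat => gamma ^+ n *
     phi ((x + (\sum_(k < n.+1) (j k * b ^ k)%N)%:R) / (b%:R ^+ n.+1)))).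

Definition condH (b : nat) (gamma : R) (phi : R -> R) : Prop :=
  forall i j : nat -> nat, in_Sigma b i -> in_Sigma b j -> i <> j ->
    ~ (forall x : R, 0 <= x <= 1 -> S_fun b gamma phi x j - S_fun b gamma phi x i = 0).

(* base-b digit expansion [0,1) -> Sigma; the uniform Bernoulli measure
   nu^{Z_+} is the image of Lebesgue measure on [0,1) under this map. *)
Definition digits (b : nat) (w : R) : nat -> nat :=
  fun k => `| (Num.floor (w * b%:R ^+ k.+1) %% b%:Z)%Z |%N.

(* m_x(A) = nu^{Z_+}({j : S(x,j) in A}) *)
Definition m_x (b : nat) (gamma : R) (phi : R -> R) (x : R) (A : set R) : R :=
  fine (lebesgue_measure
          [set w : R | 0 <= w < 1 /\ A (S_fun b gamma phi x (digits b w))]).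

Definition exact_dimensional (mu : set R -> R) (alpha : R) : Prop :=
  exists N : set R, measurable N /\ mu N = 0 /\
    forall y : R, ~ N y ->
      (fun r : R => ln (mu (ball y r)) / ln r) @ 0^'+ --> alpha.

Definition Lint (b : nat) (n : nat) (j : int) : set R :=
  [set y | j%:~R / b%:R ^+ n <= y < (j + 1)%:~R / b%:R ^+ n].

Definition Lidx (b : nat) (n : nat) (x : R) : int := Num.floor (x * b%:R ^+ n).

Definition mu_cond (b : nat) (mu : set R -> R) (x : R) (i : nat) (A : set R) : R :=
  mu (A `&` Lint b i (Lidx b i x)) / mu (Lint b i (Lidx b i x)).

Definition xlogb (b : nat) (p : R) : R := if p == 0 then 0 else p * ln p / ln b%:R.

(* H(mu_{x,i}, L_{i+m}); mu_{x,i} is supported on the L_i-interval of x, which is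
   the union of the b^m intervals of L_{i+m} indexed by Lidx*b^m + l, l < b^m;
   all other atoms of L_{i+m} have mass 0 and contribute 0. *)
Definition Hcond (b : nat) (mu : set R -> R) (x : R) (i m : nat) : R :=
  - \sum_(l < b ^ m)
      xlogb b (mu_cond b mu x i
                 (Lint b (i + m) (Lidx b i x * (b ^ m)%:Z + (nat_of_ord l)%:Z))).

Definition entropy_porous (b : nat) (mu : set R -> R) (h delta : R) (m n1 n2 : nat)
  : Prop :=
  (n2 - n1 + 1)%:R^-1 *
    (\sum_(n1 <= i < n2.+1)
        mu [set x | m%:R^-1 * Hcond b mu x i m < h + delta]) > 1 - delta.

Definition ipt (b n : nat) (i : {ffun 'I_n -> 'I_b}) (x : R) : R :=
  (x + (\sum_(k < n) (i k * b ^ k)%N)%:R) / b%:R ^+ n.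

Definition nu_n (b n : nat) (P : {ffun 'I_n -> 'I_b} -> Prop) : R :=
  #|[set i : {ffun 'I_n -> 'I_b} | `[< P i >]]|%:R / (b ^ n)%:R.

End Defs.

(* Main.v *)
(* Write [m_x] as the law of [S x] under Lebesgue measure on [0, 1), which is [nu^{Z_+}] read
   through base-[b] digits, and let [H x i] be its entropy for the partition [L_i].

   Upper bound: exact dimensionality gives [H x k ~ alpha k] (in base [b]) for a.e. [x], and since
   [H x k] changes by at most [ln 3] when [x] moves by [O(b^-k)], this passes to all but few of
   the grid points [i(0)].  Telescoping the chain rule, the average over scales and over [m_x] of
   the entropies of the components [mu_{x,i}] is then at most [(alpha + o(1)) m].

   Lower bound: by self-similarity a typical component at scale [i] is a mixture of copies of
   measures [m_y] scaled by [gamma^p ~ b^-(i + O(1))], with [y] running over a [b^-p]-grid, so by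
   concavity it has entropy at least [(alpha - o(1)) m]; copies crossing the boundary of an atom
   are negligible because, when [alpha > 0], the measures [m_x] are uniformly non-concentrated.

   An average at most [alpha + o(1)] of quantities mostly at least [alpha - o(1)] forces most of
   them to be below [alpha + eps]. *)
Require Import Defs.
From HB Require Import structures.
From mathcomp Require Import all_boot all_order all_algebra.
From mathcomp Require Import all_classical all_reals all_analysis.
From mathcomp Require Import measurable_realfun.
From mathcomp Require Import zify ring lra.
Import Order.TTheory GRing.Theory Num.Theory.
Import numFieldNormedType.Exports.
Local Open Scope classical_set_scope.
Local Open Scope ring_scope.

Set Implicit Arguments.
Unset Strict Implicit.

(** The lower bound holds for every [x] in [0, 1] from some scale [i0] on: its pieces sit over a
    grid of mesh b^-p, few points of which are bad whatever [x] is. The exceptional words therefore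
    come only from the upper bound, which at the point i(0) concerns the single number [H x k]. This
    dictates the order of choices: [k] after [m] and [i0], and [n] after [k]. The lower bound is
    kept as a family of weights [rho l <= q x i l] of total mass at least 1 - e, each unit of weight
    carrying entropy (alpha - e) m in base b. An atom whose component has entropy at least (alpha +
    eps) m has a surplus of at least eps m times its mass over this minimum. Charging the surplus
    against the upper bound is a Markov inequality with error O(e), so e is taken of order eps^2.
    Entropies are taken of unnormalised masses and in natural logarithms, with ln b as unit, so that
    conditioning on an atom needs no division until the comparison with the definition of
    porosity. *)

Section Entropy.
Variable R : realType.

(** * Finite entropy inequalities for unnormalised masses *)

Definition xent (t : R) : R := - (t * ln t).

Lemma xent0 : xent 0 = 0.
Proof. by rewrite /xent mul0r oppr0. Qed.

Lemma xent1 : xent 1 = 0.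
Proof. by rewrite /xent ln1 mulr0 oppr0. Qed.

Lemma xent_ge0 (t : R) : t <= 1 -> 0 <= t -> 0 <= xent t.
Proof.
move=> t1 t0; rewrite /xent oppr_ge0 mulr_ge0_le0 //.
exact: ln_le0.
Qed.

(** This is [ln s <= s - 1] at [s = T / t], multiplied by [t]. The last hypothesis excludes
    [T = 0 < t], where the convention [ln 0 = 0] would break it. *)
Lemma gibbs (t T : R) : 0 <= t -> 0 <= T -> (T = 0 -> t = 0) ->
  xent t <= - (t * ln T) + T - t.
Proof.
rewrite le0r => /orP[/eqP-> T0 _|t0 T0 h]; first by rewrite xent0; lra.
have Tp : 0 < T by rewrite lt_neqAle T0 andbT eq_sym; apply/eqP => /h tz; rewrite tz ltxx in t0.
have h1 : ln (T / t) <= T / t - 1.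
  have q0 : -1 < T / t - 1 by have := divr_gt0 Tp t0; lra.
  by have := le_ln1Dx q0; rewrite addrC subrK.
rewrite ln_div ?posrE // in h1.
have := ler_wpM2l (ltW t0) h1; rewrite mulrBr mulrBr mulrCA mulfV ?gt_eqF // !mulr1 /xent.
lra.
Qed.

Lemma gibbs_sum (I : finType) (p T : I -> R) :
  (forall i, 0 <= p i) -> (forall i, 0 <= T i) -> (forall i, T i = 0 -> p i = 0) ->
  \sum_i xent (p i) <= - (\sum_i p i * ln (T i)) + \sum_i T i - \sum_i p i.
Proof.
move=> p0 T0 h; rewrite -!sumrN -!big_split /=; apply: ler_sum => i _.
exact: gibbs (p0 i) (T0 i) (h i).
Qed.

Lemma sum_ge0_eq0 (I : finType) (p : I -> R) :
  (forall i, 0 <= p i) -> \sum_i p i = 0 -> forall i, p i = 0.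
Proof.
by move=> p0 s i; apply: (psumr_eq0P (P := predT) _ s).
Qed.

Lemma ler_sum_mem (I : finType) (p : I -> R) :
  (forall i, 0 <= p i) -> forall i, p i <= \sum_j p j.
Proof. by move=> p0 i; rewrite (bigD1 i) //= lerDl sumr_ge0. Qed.

Lemma xent_sum_card (I : finType) (p : I -> R) (A : {set I}) (c : nat) :
  (forall i, 0 <= p i) -> (forall i, p i != 0 -> i \in A) -> (#|A| <= c)%N ->
  \sum_i xent (p i) <= xent (\sum_i p i) + (\sum_i p i) * ln c%:R.
Proof.
move=> p0 pA Ac; set P := \sum_i p i.
have P0 : 0 <= P by apply: sumr_ge0.
have [Pz|Pn] := eqVneq P 0.
  rewrite Pz xent0 mul0r addr0 big1 // => i _.
  by rewrite (sum_ge0_eq0 p0 Pz) xent0.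
have Pp : 0 < P by rewrite lt_neqAle eq_sym Pn.
have c0 : (0 < c)%N.
  case: c Ac => [|//]; rewrite leqn0 cards_eq0 => /eqP Ae.
  suff : P = 0 by move/eqP; rewrite (negbTE Pn).
  apply: big1 => i _; apply/eqP/contraT => /pA; by rewrite Ae inE.
have c0R : 0 < c%:R :> R by rewrite ltr0n.
(* Comparison with the uniform mass; [A] may have fewer than [c] elements, so [T] has total at most
   [P]. *)
pose T i := if i \in A then P / c%:R else 0.
have T0 i : 0 <= T i by rewrite /T; case: ifP => // _; rewrite divr_ge0 // ltW.
have Th i : T i = 0 -> p i = 0.
  rewrite /T; case: ifP => [_ /eqP|/negbT iA _].
    by rewrite mulf_eq0 invr_eq0 (negbTE Pn) (gt_eqF c0R).
  by apply/eqP; apply: contraT => /pA; rewrite (negbTE iA).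
apply: le_trans (gibbs_sum p0 T0 Th) _.
have -> : \sum_i p i * ln (T i) = P * (ln P - ln c%:R).
  rewrite /P mulr_suml; apply: eq_bigr => i _; rewrite /T; case: ifP => [_|/negbT iA].
    by rewrite ln_div ?posrE.
  suff -> : p i = 0 by rewrite !mul0r.
  by apply/eqP; apply: contraT => /pA; rewrite (negbTE iA).
have : \sum_i T i <= P.
  rewrite /T -big_mkcond /= sumr_const -[leRHS](@divfK _ c%:R) ?gt_eqF //.
  by rewrite -[leLHS]mulr_natr ler_wpM2l ?ler_nat // divr_ge0 // ltW.
rewrite -/P /xent; lra.
Qed.

Lemma xent_sum_le (I : finType) (p : I -> R) :
  (forall i, 0 <= p i) -> xent (\sum_i p i) <= \sum_i xent (p i).
Proof.
move=> p0; rewrite /xent mulr_suml -sumrN; apply: ler_sum => i _.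
rewrite lerN2; have := p0 i; rewrite le0r => /orP[/eqP->|pi]; first by rewrite !mul0r.
rewrite ler_pM2l // ler_ln ?posrE //; first exact: ler_sum_mem.
exact: lt_le_trans pi (ler_sum_mem p0 i).
Qed.

(* Conditioning reduces entropy: [H(L) >= H(L | U)] for a joint law [r] of [(U, L)]. *)
Lemma entropy_cond_le (U L : finType) (r : U -> L -> R) :
  (forall u l, 0 <= r u l) ->
  \sum_u (\sum_l xent (r u l) - xent (\sum_l r u l)) <=
  \sum_l xent (\sum_u r u l) - xent (\sum_u \sum_l r u l).
Proof.
move=> r0; set P := \sum_u \sum_l r u l; pose Ru u := \sum_l r u l; pose C l := \sum_u r u l.
have R0 u : 0 <= Ru u by apply: sumr_ge0.
have C0 l : 0 <= C l by apply: sumr_ge0.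
have P0 : 0 <= P by apply: sumr_ge0 => u _; exact: R0.
have PC : P = \sum_l C l by rewrite /P exchange_big.
have [Pz|Pn] := eqVneq P 0.
  have Rz u : Ru u = 0 by apply: (sum_ge0_eq0 R0).
  have rz u l : r u l = 0 by apply: (sum_ge0_eq0 (r0 u)); exact: Rz.
  rewrite big1; last first.
    move=> u _; rewrite -/(Ru u) Rz xent0 subr0 big1 // => l _; by rewrite rz xent0.
  by rewrite Pz xent0 subr0 big1 // => l _; rewrite big1 ?xent0.
have Pp : 0 < P by rewrite lt_neqAle eq_sym Pn.
have rR u l : r u l <= Ru u := ler_sum_mem (r0 u) l.
have rC u l : r u l <= C l := ler_sum_mem (fun u => r0 u l) u.
(* Gibbs against the product of the marginals [Ru u * C l / P]: mutual information is
   nonnegative. *)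
have key u l : xent (r u l) <= - (r u l * ln (Ru u)) - r u l * ln (C l) + r u l * ln P
   + Ru u * C l / P - r u l.
  have T0 : 0 <= Ru u * C l / P by rewrite divr_ge0 // mulr_ge0.
  have Th : Ru u * C l / P = 0 -> r u l = 0.
    move/eqP; rewrite !mulf_eq0 invr_eq0 (negbTE Pn) orbF => /orP[]/eqP z.
      by apply/eqP; rewrite eq_le r0 andbT -z.
    by apply/eqP; rewrite eq_le r0 andbT -z.
  have := gibbs (r0 u l) T0 Th.
  have := r0 u l; rewrite le0r => /orP[/eqP-> _|rp h].
    by rewrite xent0; move: T0; lra.
  apply: le_trans h _.
  have Rp := lt_le_trans rp (rR u l); have Cp := lt_le_trans rp (rC u l).
  by rewrite ln_div ?posrE ?mulr_gt0 // lnM ?posrE //; lra.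
have : \sum_u \sum_l xent (r u l) <= \sum_u \sum_l (- (r u l * ln (Ru u)) - r u l * ln (C l) + r u l * ln P
   + Ru u * C l / P - r u l) by apply: ler_sum => u _; apply: ler_sum => l _.
have -> : \sum_u \sum_l (- (r u l * ln (Ru u)) - r u l * ln (C l) + r u l * ln P
   + Ru u * C l / P - r u l) = \sum_u xent (Ru u) + \sum_l xent (C l) - xent P.
  have e1 : \sum_u xent (Ru u) = \sum_u \sum_l - (r u l * ln (Ru u)).
    by apply: eq_bigr => u _; rewrite /xent [in LHS]/Ru mulr_suml sumrN.
  have e2 : \sum_l xent (C l) = \sum_u \sum_l - (r u l * ln (C l)).
    by rewrite exchange_big; apply: eq_bigr => l _; rewrite /xent [in LHS]/C mulr_suml sumrN.
  have e3 : - xent P = \sum_u \sum_l (r u l * ln P).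
    rewrite /xent opprK [in X in X * _]/P mulr_suml; apply: eq_bigr => u _.
    by rewrite mulr_suml.
  have e4 : \sum_u \sum_l (Ru u * C l / P) = P.
    under eq_bigr => u _ do rewrite -mulr_suml -mulr_sumr -PC mulfK //.
    by [].
  transitivity (\sum_u \sum_l - (r u l * ln (Ru u)) + \sum_u \sum_l - (r u l * ln (C l)) +
    \sum_u \sum_l (r u l * ln P) + \sum_u \sum_l (Ru u * C l / P) - \sum_u \sum_l r u l).
    rewrite -sumrN -!big_split /=; apply: eq_bigr => u _.
    by rewrite -sumrN -!big_split.
  by rewrite e4 -/P addrK e1 e2 -e3.
rewrite sumrB => h; rewrite lerBlDl; move: h; rewrite /Ru /C; lra.
Qed.

Lemma card_ord_spread (n c : nat) (A : {set 'I_n}) :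
  (forall i j, i \in A -> j \in A -> i < j + c)%N -> (#|A| <= c)%N.
Proof.
move=> h; have [->|[i0 i0A]] := set_0Vmem A; first by rewrite cards0.
case: (arg_minnP (fun i : 'I_n => i : nat) i0A) => a aA amin.
have lt (i : 'I_n) : i \in A -> (i - a < c)%N.
  by move=> iA; have := h i a iA aA; have := amin i iA; lia.
have c0 : (0 < c)%N by have := lt a aA; lia.
pose f (i : 'I_n) : 'I_c := insubd (Ordinal c0) (i - a)%N.
have finj : {in A &, injective f}.
  move=> i j iA jA /(congr1 val); rewrite !val_insubd !lt // => e.
  by apply: val_inj; have := amin i iA; have := amin j jA; move: e => /=; lia.
by rewrite -(card_in_imset finj) (leq_trans (max_card _)) // card_ord.
Qed.

(** For the joint law [p] of (I, J): H(I) <= H(I, J) = H(J) + H(I | J), and given [j] at most [c]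
    values of [i] remain. *)
Lemma entropy_compare (I J : finType) (p : I -> J -> R) (c : nat) (A : J -> {set I}) :
  (forall i j, 0 <= p i j) -> (forall i j, p i j != 0 -> i \in A j) ->
  (forall j, #|A j| <= c)%N ->
  \sum_i xent (\sum_j p i j) <=
  \sum_j xent (\sum_i p i j) + (\sum_i \sum_j p i j) * ln c%:R.
Proof.
move=> p0 pA Ac.
apply: (@le_trans _ _ (\sum_i \sum_j xent (p i j))).
  by apply: ler_sum => i _; exact: xent_sum_le.
rewrite exchange_big /= [X in _ + X * _]exchange_big /= mulr_suml -big_split /=.
apply: ler_sum => j _; apply: (xent_sum_card (A := A j)) => [i|i|]; [exact: p0|exact: pA|exact: Ac].
Qed.

(** [xent] itself is not homogeneous, but the terms in [a * ln a] cancel between the joint and the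
    marginal entropy. *)
Lemma xent_scale_cond (L : finType) (a : R) (t : L -> R) : 0 < a -> (forall l, 0 <= t l) ->
  \sum_l xent (a * t l) - xent (\sum_l a * t l) = a * (\sum_l xent (t l) - xent (\sum_l t l)).
Proof.
move=> a0 t0.
have e s : 0 <= s -> xent (a * s) = a * xent s - a * ln a * s.
  rewrite le0r => /orP[/eqP->|sp]; first by rewrite !mulr0 xent0 mulr0 subr0.
  by rewrite /xent lnM ?posrE //; ring.
rewrite -mulr_sumr e ?sumr_ge0 // (eq_bigr (fun l => a * xent (t l) - a * ln a * t l)).
  by rewrite sumrB -!mulr_sumr; ring.
by move=> l _; rewrite e.
Qed.

End Entropy.

(** * The probability space [0, 1) with Lebesgue measure *)

Section UnitInterval.
Variable R : realType.

Definition unit01 : set R := [set w | 0 <= w < 1].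

Lemma unit01E : unit01 = [set` `[0, 1[].
Proof. by apply/seteqP; split => w; rewrite /unit01 /= in_itv. Qed.

Lemma measurable_unit01 : measurable unit01.
Proof. by rewrite unit01E; exact: measurable_itv. Qed.

Definition pr (E : set R) : R := fine (lebesgue_measure (unit01 `&` E)).

(** The bundled measure behind [pr], to which the general measure theorems apply. *)
Definition uniform01 := mrestr (@lebesgue_measure R) measurable_unit01.

Lemma prE (E : set R) : pr E = fine (uniform01 E).
Proof. by rewrite /uniform01 /mrestr setIC. Qed.

Lemma uniform01_le1 (E : set R) : measurable E -> (uniform01 E <= 1)%E.
Proof.
move=> mE; rewrite /uniform01 /mrestr.
apply: (@le_trans _ _ (lebesgue_measure unit01)).
  apply: le_measure; rewrite ?inE //; [|exact: measurable_unit01].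
  by apply: measurableI => //; exact: measurable_unit01.
by rewrite unit01E lebesgue_measure_itv /= lte_fin ltr01 oppr0 adde0.
Qed.

Lemma uniform01_fin (E : set R) : measurable E -> uniform01 E \is a fin_num.
Proof.
move=> mE; rewrite ge0_fin_numE ?measure_ge0 //.
exact: le_lt_trans (uniform01_le1 mE) (ltry _).
Qed.

Lemma pr_ge0 (E : set R) : 0 <= pr E.
Proof. by rewrite /pr fine_ge0. Qed.

Lemma pr_le1 (E : set R) : measurable E -> pr E <= 1.
Proof.
move=> mE; rewrite prE -lee_fin fineK ?uniform01_fin //; exact: uniform01_le1.
Qed.

Lemma pr_full (E : set R) : (forall w, unit01 w -> E w) -> pr E = 1.
Proof.
move=> h; rewrite /pr (_ : _ `&` _ = unit01); last first.
  by apply/seteqP; split => w /=; [case|move=> u; split => //; exact: h].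
by rewrite unit01E lebesgue_measure_itv /= lte_fin ltr01 oppr0 adde0.
Qed.

Lemma pr_empty (E : set R) : (forall w, unit01 w -> ~ E w) -> pr E = 0.
Proof.
move=> h; rewrite /pr (_ : _ `&` _ = set0) ?measure0 //.
by apply/seteqP; split => w //= -[/h].
Qed.

Lemma pr_ext (E F : set R) : (forall w, unit01 w -> E w <-> F w) -> pr E = pr F.
Proof.
move=> h; rewrite /pr; congr (fine (lebesgue_measure _)).
by apply/seteqP; split => w [u /(h _ u)].
Qed.

Lemma pr_le (E F : set R) : measurable E -> measurable F ->
  (forall w, unit01 w -> E w -> F w) -> pr E <= pr F.
Proof.
move=> mE mF h; rewrite /pr.
have mi G : measurable G -> measurable (unit01 `&` G).
  by move=> mG; apply: measurableI => //; exact: measurable_unit01.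
rewrite fine_le //.
- by move: (uniform01_fin mE); rewrite /uniform01 /mrestr setIC.
- by move: (uniform01_fin mF); rewrite /uniform01 /mrestr setIC.
- apply: le_measure; rewrite ?inE; [exact: mi|exact: mi|].
  by move=> w [u /(h _ u)].
Qed.

Lemma prU (E F : set R) : measurable E -> measurable F ->
  (forall w, unit01 w -> E w -> F w -> False) -> pr (E `|` F) = pr E + pr F.
Proof.
move=> mE mF h; rewrite /pr setIUr measureU ?fineD //.
- by move: (uniform01_fin mE); rewrite /uniform01 /mrestr setIC.
- by move: (uniform01_fin mF); rewrite /uniform01 /mrestr setIC.
- by apply: measurableI => //; exact: measurable_unit01.
- by apply: measurableI => //; exact: measurable_unit01.
- by apply/seteqP; split => w //= -[[u e] [_ f]]; exact: h u e f.
Qed.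

Lemma measurable_pred_nat (g : R -> nat) : (forall l, measurable [set w | g w = l]) ->
  forall P : nat -> Prop, measurable [set w | P (g w)].
Proof.
move=> mg P; rewrite (_ : [set w | _] = \bigcup_(l in [set l | P l]) [set w | g w = l]).
  by apply: bigcup_measurable => l _.
by apply/seteqP; split => w /= => [Pw|[l /= Pl e]]; [exists (g w)|rewrite e].
Qed.

Lemma pr_partition (g : R -> nat) (n : nat) (E : set R) :
  (forall l, measurable [set w | g w = l]) -> (forall w, unit01 w -> (g w < n)%N) ->
  measurable E -> pr E = \sum_(l < n) pr (E `&` [set w | g w = l]).
Proof.
move=> mg gn mE.
have key k : pr (E `&` [set w | (g w < k)%N]) = \sum_(l < k) pr (E `&` [set w | g w = l]).
  elim: k => [|k IH]; first by rewrite big_ord0 pr_empty // => w _ [].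
  rewrite big_ord_recr /= -IH -prU.
  - apply: pr_ext => w _; split => /=.
      by move=> [Ew]; rewrite ltnS leq_eqVlt => /orP[/eqP|] ?; [right|left].
    by move=> [[Ew h]|[Ew h]]; split => //=; rewrite ltnS ?h // ltnW.
  - apply: measurableI => //; exact: (measurable_pred_nat mg (fun l => (l < k)%N)).
  - exact: measurableI.
  - by move=> w _ /= [_ h1] [_ h2]; rewrite h2 ltnn in h1.
rewrite -key; apply: pr_ext => w u; split => [Ew|[]//]; split => //=; exact: gn.
Qed.

(** Almost every point leaves the [E n] for good, so their lim sup is null, and the decreasing tail
    unions have measure tending to 0 by continuity from above. *)
Lemma pr_limsup0 (E : nat -> set R) (N : set R) : (forall n, measurable (E n)) ->
  measurable N -> pr N = 0 ->
  (forall w, unit01 w -> ~ N w -> exists M, forall m, (M <= m)%N -> ~ E m w) ->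
  forall e, 0 < e -> exists M, forall m, (M <= m)%N -> pr (E m) <= e.
Proof.
move=> mE mN N0 h e e0.
have mU n : measurable (\bigcup_(j >= n) E j) by apply: bigcup_measurable.
have fin0 : (uniform01 (\bigcup_(k >= 0) E k) < +oo)%E.
  exact: le_lt_trans (uniform01_le1 (mU _)) (ltry _).
have mL : measurable (lim_sup_set E).
  by apply: bigcap_measurable => // n _; exact: mU.
have L0 : uniform01 (lim_sup_set E) = 0%E.
  rewrite -(fineK (uniform01_fin mL)) -prE; congr EFin.
  apply: le_anti; rewrite pr_ge0 andbT -N0; apply: pr_le => // w u wl.
  apply: contrapT => /(h w u) [M hM].
  by have [j /= Mj Ej] := wl M I; exact: hM j Mj Ej.
have cv : uniform01 (\bigcup_(j >= n) E j) @[n --> \oo] --> 0%E.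
  by rewrite -L0; exact: lim_sup_set_cvg.
have cv' : (fine \o (fun n => uniform01 (\bigcup_(j >= n) E j))) x @[x --> \oo] --> (0 : R).
  exact: fine_cvg.
have [M _ hM] := cvgr_lt _ cv' _ e0.
exists M => m Mm; apply: le_trans (ltW (hM M (leqnn M))).
rewrite /= -[fine _]prE; apply: pr_le => // w _ Em; by exists m.
Qed.

(** The rescaled image of Lebesgue measure under [w -> (d + w) / b] gives intervals their length, so
    uniqueness of Lebesgue measure applies. *)
Lemma lebesgue_affine (b d : R) (A : set R) : 0 < b -> measurable A ->
  lebesgue_measure A = (b^-1%:E * lebesgue_measure [set w : R | A ((d + w) / b)%R])%E.
Proof.
move=> b0 mA.
pose f : measurableTypeR R -> measurableTypeR R := fun w => (d + w) / b.
have mf : measurable_fun [set: measurableTypeR R] f.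
  apply: nondecreasing_measurable => // x y xy.
  by rewrite /f ler_pM2r ?invr_gt0 // lerD2l.
have b1 : 0 <= b^-1 by rewrite invr_ge0 ltW.
pose nu := mscale (NngNum b1) (pushforward (@lebesgue_measure R) f).
rewrite (@lebesgue_measure_unique R (nu mf)) //.
move=> X [[x y] /= _ <-]; rewrite /nu /mscale /= /pushforward.
rewrite (_ : f @^-1` _ = [set` `]b * x - d, b * y - d]]).
  rewrite !lebesgue_measure_itv /= !lte_fin ltrD2r ltr_pM2l //.
  case: ifP => _; last by rewrite mule0.
  rewrite !EFinN -!EFinB -EFinM; congr EFin; field.
  by rewrite gt_eqF.
apply/seteqP; split => w /=; rewrite !in_itv /= /f ltr_pdivlMr // ler_pdivrMr // => /andP[h1 h2];
  apply/andP; split; lra.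
Qed.

End UnitInterval.

Lemma lipschitz_periodic_bounded (R : realType) (phi : R -> R) :
  (forall x, phi (x + 1) = phi x) ->
  (exists L : R, forall x y : R, `|phi x - phi y| <= L * `|x - y|) ->
  exists B, forall x, `|phi x| <= B.
Proof.
move=> per [L hL].
have pern (n : nat) x : phi (x + n%:R) = phi x.
  elim: n => [|n IH]; first by rewrite addr0.
  by rewrite -natr1 addrA per.
have perz (z : int) x : phi (x + z%:~R) = phi x.
  case: z => n; first exact: pern.
  by rewrite NegzE mulrNz -(pern n.+1 (x - _)) subrK.
have L0 : 0 <= L by have := hL 1 0; rewrite subr0 normr1 mulr1; apply: le_trans.
exists (`|phi 0| + L) => x.
have -> : phi x = phi (x - (Num.floor x)%:~R) by rewrite -(perz (Num.floor x) (x - _)) subrK.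
set y := x - _; have /andP[y1 y2] := floor_itv x.
rewrite intrD in y2.
have hy : `|y| <= 1 by rewrite ger0_norm /y; lra.
have := hL y 0; rewrite subr0 => h.
have := ler_normD (phi y - phi 0) (phi 0); rewrite subrK => h2.
have : L * `|y| <= L * 1 by rewrite ler_wpM2l.
lra.
Qed.

(** * The series S: bounds, dependence on [x], first-digit recursion, measurability *)

Section Sfun.
Variables (R : realType) (b : nat) (gamma : R) (phi : R -> R) (B L : R).
Hypotheses (b2 : (2 <= b)%N) (gamma01 : 0 < gamma < 1).
Hypothesis phi_bound : forall x, `|phi x| <= B.
Hypothesis phi_lip : forall x y, `|phi x - phi y| <= L * `|x - y|.

Definition Sdig (x w : R) : R := S_fun b gamma phi x (digits b w).
Local Notation Sw := Sdig.

Let g0 : 0 < gamma. Proof. by case/andP: gamma01. Qed.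
Let g1 : gamma < 1. Proof. by case/andP: gamma01. Qed.
Let bpos : 0 < b%:R :> R. Proof. by rewrite ltr0n; apply: leq_trans b2. Qed.
Let bge1 : 1 <= b%:R :> R. Proof. by rewrite ler1n; apply: leq_trans b2. Qed.
Let B0 : 0 <= B. Proof. exact: le_trans (normr_ge0 _) (phi_bound 0). Qed.
Let L0 : 0 <= L.
Proof. by have := phi_lip 1 0; rewrite subr0 normr1 mulr1; apply: le_trans. Qed.
Let normg : `|gamma| < 1. Proof. by rewrite gtr0_norm. Qed.

Let term x (j : nat -> nat) (n : nat) : R := gamma ^+ n *
  phi ((x + (\sum_(k < n.+1) (j k * b ^ k)%N)%:R) / (b%:R ^+ n.+1)).

Lemma geometric_dominated (u : nat -> R) (c : R) : 0 <= c ->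
  (forall n, `|u n| <= c * gamma ^+ n) ->
  cvgn (series u) /\ `|limn (series u)| <= c / (1 - gamma).
Proof.
move=> c0 hu.
have cs : cvgn (series u).
  apply: normed_cvg; apply: (series_le_cvg _ _ hu) => [n|n|].
  - exact: normr_ge0.
  - by rewrite mulr_ge0 // exprn_ge0 // ltW.
  - exact: is_cvg_geometric_series.
split => //.
have bd n : `|series u n| <= c / (1 - gamma).
  apply: le_trans (geometric_le_lim n c0 g0 normg).
  rewrite /series /= ; apply: le_trans (ler_norm_sum _ _ _) _.
  by apply: ler_sum => i _; exact: hu.
by rewrite ler_norml; apply/andP; split; [apply: limr_ge|apply: limr_le] => //;
  apply: nearW => n; have := bd n; rewrite ler_norml => /andP[].
Qed.

Lemma term_bound x j n : `|term x j n| <= B * gamma ^+ n.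
Proof.
rewrite /term normrM ger0_norm ?exprn_ge0 ?(ltW g0) // mulrC.
by rewrite ler_wpM2r // exprn_ge0 // ltW.
Qed.

Lemma S_fun_cvg x j : series (term x j) @ \oo --> S_fun b gamma phi x j.
Proof. by have [h _] := geometric_dominated B0 (term_bound x j). Qed.

Lemma S_fun_bound x j : `|S_fun b gamma phi x j| <= B / (1 - gamma).
Proof. by have [_ h] := geometric_dominated B0 (term_bound x j). Qed.

(** Division by [b ^ n.+1] only contracts, so the term of index [n] is [L * gamma ^ n]-Lipschitz;
    the constants are summed. *)
Lemma S_fun_lipschitz x y j :
  `|S_fun b gamma phi x j - S_fun b gamma phi y j| <= L / (1 - gamma) * `|x - y|.
Proof.
have c0 : 0 <= L * `|x - y| by rewrite mulr_ge0.
have hu n : `|(term x j - term y j) n| <= L * `|x - y| * gamma ^+ n.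
  rewrite /term /= -[(_ - _) n]/(_ - _) -mulrBr normrM ger0_norm ?exprn_ge0 ?(ltW g0) // mulrC.
  rewrite ler_wpM2r ?exprn_ge0 ?(ltW g0) //.
  apply: le_trans (phi_lip _ _) _; rewrite ler_wpM2l //.
  rewrite -mulrBl (_ : x + _ - _ = x - y); last by ring.
  rewrite normrM ler_piMr // normfV.
  rewrite invf_le1 ?normr_gt0 ?expf_neq0 ?gt_eqF // ger0_norm ?exprn_ge0 ?(ltW bpos) //.
  exact: exprn_ege1.
have [_] := geometric_dominated c0 hu.
have -> : limn (series (term x j - term y j)) = S_fun b gamma phi x j - S_fun b gamma phi y j.
  apply: cvg_lim => //.
  have -> : series (term x j - term y j) = (fun n => series (term x j) n - series (term y j) n).
    by apply/funext => n; rewrite /series /= -sumrB.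
  by apply: cvgB; exact: S_fun_cvg.
by rewrite mulrAC.
Qed.

(** On [0, 1) the map [w -> (d + w) / b] prepends the digit [d]; [digits_affineS] gives the
    remaining digits. *)
Lemma digits_affine0 (d : nat) (w : R) : (d < b)%N -> unit01 w ->
  digits b ((d%:R + w) / b%:R) 0 = d.
Proof.
move=> db /andP[w0 w1]; rewrite /digits expr1 divfK ?gt_eqF //.
rewrite (@floor_def _ _ d%:Z); last by rewrite intrD -!pmulrn; lra.
by rewrite modz_nat absz_nat modn_small.
Qed.

Lemma digits_affineS (d : nat) (w : R) k : unit01 w ->
  digits b ((d%:R + w) / b%:R) k.+1 = digits b w k.
Proof.
move=> /andP[w0 w1]; rewrite /digits.
have -> : (d%:R + w) / b%:R * b%:R ^+ k.+2 = (d * b ^ k.+1)%N%:Z%:~R + w * b%:R ^+ k.+1 :> R.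
  rewrite [b%:R ^+ k.+2]exprS mulrA divfK ?gt_eqF // mulrDl -pmulrn natrM natrX //.
rewrite floorDzr ?intr_int // intrKfloor.
by rewrite expnSr mulnA PoszM modzMDl.
Qed.

(** The first term of the series is split off; the remaining digits see the base point
    [(x + d) / b]. *)
Lemma S_fun_affine x (d : nat) (w : R) : (d < b)%N -> unit01 w ->
  Sw x ((d%:R + w) / b%:R) = phi ((x + d%:R) / b%:R) + gamma * Sw ((x + d%:R) / b%:R) w.
Proof.
move=> db u; rewrite /Sdig; apply: cvg_lim => //.
set j := digits b _; set y := (x + d%:R) / _.
rewrite -/(term x j).
rewrite -[series _]/(series (term x j)) -cvg_shiftS.
have -> : [sequence series (term x j) n.+1]_n =
   (fun n => phi y + gamma * series (term y (digits b w)) n).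
  apply/funext => n; rewrite /= /series /= big_nat_recl // mulr_sumr; congr (_ + _).
    rewrite /term expr0 mul1r expr1 big_ord1 expn0 muln1 /j digits_affine0 //.
  apply: eq_bigr => k _; rewrite /term exprS mulrA; congr (_ * phi _).
  rewrite big_ord_recl expn0 muln1 /j digits_affine0 //.
  rewrite /y natrD addrA [b%:R ^+ k.+2]exprS.
  have -> : (\sum_(i < k.+1) digits b ((d%:R + w) / b%:R) (lift ord0 i) * b ^ (lift ord0 i))%N =
     (b * \sum_(i < k.+1) digits b w i * b ^ i)%N.
    rewrite big_distrr /=; apply: eq_bigr => i _.
    by rewrite /bump add1n digits_affineS // expnS mulnCA.
  have e0 : b%:R ^+ k.+1 != 0 :> R by rewrite expf_neq0 // gt_eqF.
  rewrite natrM; field.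
  by rewrite e0 gt_eqF.
apply: cvgD; first exact: cvg_cst.
by apply: cvgMr; exact: S_fun_cvg.
Qed.

Lemma measurable_floor_eq (c : R) (z : int) : 0 <= c -> measurable [set w : R | Num.floor (w * c) = z].
Proof.
move=> c0.
have mf : measurable_fun [set: R] (fun w : R => w * c).
  by apply: nondecreasing_measurable => // x y xy; rewrite ler_wpM2r.
have := mf measurableT _ (measurable_itv `[z%:~R, (z + 1)%:~R[).
rewrite setTI (_ : _ @^-1` _ = [set w : R | Num.floor (w * c) = z]) //.
apply/seteqP; split => w /=; rewrite in_itv /= -floor_eq; first by move/eqP.
by move=> ->.
Qed.

Lemma measurable_absz_floor (c : R) l : 0 <= c -> measurable [set w : R | `|Num.floor (w * c)|%N = l].
Proof.
move=> c0; rewrite (_ : [set _ | _] = [set w : R | Num.floor (w * c) = l%:Z] `|`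
    [set w : R | Num.floor (w * c) = - l%:Z]).
  by apply: measurableU; exact: measurable_floor_eq.
apply/seteqP; split => w /=; last by move=> [] ->; rewrite ?abszN.
by case: (Num.floor _) => n <-; [left|right].
Qed.

Lemma measurable_digits k l : measurable [set w : R | digits b w k = l].
Proof.
have c0 : 0 <= b%:R ^+ k.+1 :> R by rewrite exprn_ge0 // ltW.
rewrite (_ : [set _ | _] = \bigcup_(n in [set n : nat | `|(n%:Z %% b%:Z)%Z|%N = l])
    [set w | Num.floor (w * b%:R ^+ k.+1) = n%:Z] `|`
   \bigcup_(n in [set n : nat | `|((- n%:Z) %% b%:Z)%Z|%N = l])
    [set w | Num.floor (w * b%:R ^+ k.+1) = (- n%:Z)]).
  apply: measurableU; apply: bigcup_measurable => n _; exact: measurable_floor_eq.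
apply/seteqP; split => w /=; rewrite /digits; last first.
  by move=> [[n /= h e]|[n /= h e]]; rewrite e.
case e : (Num.floor _) => [n|n] h; [left; exists n|right; exists n.+1] => //=.
Qed.

Lemma measurable_fun_digits k : measurable_fun [set: R] (fun w : R => (digits b w k)%:R : R).
Proof.
move=> _ Y mY; rewrite setTI.
exact: (measurable_pred_nat (measurable_digits k) (fun l => Y l%:R)).
Qed.

Lemma measurable_S_fun x : measurable_fun [set: R] (Sw x).
Proof.
apply: (measurable_fun_cvg (h := fun n w => series (term x (digits b w)) n)); last first.
  by move=> w _; exact: S_fun_cvg.
move=> m; rewrite /series /=; apply: measurable_sum => n.
apply: measurable_funM; first exact: measurable_cst.
apply: (measurableT_comp (f := phi)); first last.
  apply: measurable_funM; last exact: measurable_cst.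
  apply: measurable_funD; first exact: measurable_cst.
  under eq_fun => w do rewrite natr_sum.
  apply: measurable_sum => k; under eq_fun => w do rewrite natrM.
  by apply: measurable_funM; [exact: measurable_fun_digits|exact: measurable_cst].
apply: continuous_measurable_fun => y.
apply/cvgrPdist_lt => e e0; apply/nbhs_ballP.
have d0 : 0 < e / (L + 1) by rewrite divr_gt0 // ltr_wpDl.
exists (e / (L + 1)) => //= z; rewrite /ball /= => hz.
apply: le_lt_trans (phi_lip _ _) _; rewrite ltr_pdivlMr ?ltr_wpDl // in hz.
by apply: le_lt_trans hz; rewrite mulrC ler_wpM2l // lerDl.
Qed.

End Sfun.

Lemma sum_ord_mul (R : realType) (n m : nat) (F : nat -> R) :
  \sum_(s < n * m) F s = \sum_(i < n) \sum_(j < m) F (i * m + j)%N.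
Proof.
elim: n => [|n IH]; first by rewrite mul0n !big_ord0.
rewrite big_ord_recr /= -IH -(big_mkord xpredT F) mulSnr (@big_cat_nat _ _ _ (n * m)%N) ?leq_addr //=.
rewrite big_mkord; congr (_ + _).
by rewrite -{1}(add0n (n * m)%N) big_addn addKn big_mkord; apply: eq_bigr => j _; rewrite addnC.
Qed.

(** * Entropy of integer-valued random variables *)

Section Partitions.
Variables (R : realType).

Lemma pr_neq0 (E : set R) : pr E != 0 -> exists2 w, unit01 w & E w.
Proof.
move=> h; apply: contrapT => hn; move/eqP: h; apply; apply: pr_empty => w u Ew.
by apply: hn; exists w.
Qed.

Lemma sum_pr (f : R -> nat) (n : nat) : (forall l, measurable [set w | f w = l]) ->
  (forall w, unit01 w -> (f w < n)%N) -> \sum_(l < n) pr [set w | f w = l] = 1.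
Proof.
move=> mf fn; rewrite -(@pr_full R setT) //.
rewrite (pr_partition mf fn) //; apply: eq_bigr => l _.
by apply: pr_ext => w _; split => // -[].
Qed.

(** [entropy_compare] for the joint law of [f] and [g]: on a level set of [g] the values of [f] lie
    in a window of length [c]. It turns closeness of random variables into closeness of
    entropies. *)
Lemma entropy_spread (f g : R -> nat) (n k c : nat) :
  (forall l, measurable [set w | f w = l]) -> (forall l, measurable [set w | g w = l]) ->
  (forall w, unit01 w -> (f w < n)%N) -> (forall w, unit01 w -> (g w < k)%N) ->
  (forall w w', unit01 w -> unit01 w' -> g w = g w' -> (f w < f w' + c)%N) ->
  \sum_(l < n) xent (pr [set w | f w = l]) <=
  \sum_(l < k) xent (pr [set w | g w = l]) + ln c%:R.
Proof.
move=> mf mg fn gk fg.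
pose p (i : 'I_n) (j : 'I_k) := pr ([set w | f w = i] `&` [set w | g w = j]).
have rowE (i : 'I_n) : pr [set w | f w = i] = \sum_j p i j.
  exact: (pr_partition mg gk).
have colE (j : 'I_k) : pr [set w | g w = j] = \sum_i p i j.
  rewrite (pr_partition mf fn) //; apply: eq_bigr => i _.
  by rewrite setIC.
have p0 i j : 0 <= p i j by exact: pr_ge0.
have tot : \sum_i \sum_j p i j = 1.
  by under eq_bigr => i _ do rewrite -rowE; exact: sum_pr.
under eq_bigr => i _ do rewrite rowE.
under [X in _ <= X + _]eq_bigr => j _ do rewrite colE.
rewrite -[ln _]mul1r -[X in X * _]tot.
apply: (entropy_compare (A := fun j => [set i | p i j != 0]%SET)) => //.
  by move=> i j; rewrite inE.
move=> j; apply: card_ord_spread => i i'; rewrite !inE.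
move=> /pr_neq0 [w u /= [<- gj]] /pr_neq0 [w' u' /= [<- gj']].
by apply: fg => //; rewrite gj gj'.
Qed.

End Partitions.

Lemma natr_close (R : realType) (n n' : nat) : `|n%:R - n'%:R : R| < 1 -> n = n'.
Proof.
have lt i j : (i%:R - j%:R : R) < 1 -> (i <= j)%N.
  by rewrite ltrBlDl natr1 ltr_nat ltnS.
move=> h; apply/eqP; rewrite eqn_leq !lt //.
  by apply: le_lt_trans h; rewrite distrC ler_norm.
exact: le_lt_trans (ler_norm _) h.
Qed.

(** * Decomposition of [m_x] into self-similar pieces *)

Section Discretize.
Variables (R : realType) (b : nat) (gamma : R) (phi : R -> R) (B L : R) (D : nat).
Hypotheses (b2 : (2 <= b)%N) (gamma01 : 0 < gamma < 1).
Hypothesis phi_bound : forall x, `|phi x| <= B.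
Hypothesis phi_lip : forall x y, `|phi x - phi y| <= L * `|x - y|.
Hypothesis D_large : B / (1 - gamma) < D%:R.

Local Notation Sw := (Sdig b gamma phi).

Let g0 : 0 < gamma. Proof. by case/andP: gamma01. Qed.
Let g1 : gamma < 1. Proof. by case/andP: gamma01. Qed.
Let bpos : 0 < b%:R :> R. Proof. by rewrite ltr0n; apply: leq_trans b2. Qed.
Let bXpos n : 0 < b%:R ^+ n :> R. Proof. by rewrite exprn_gt0. Qed.
Let bge1 : 1 <= b%:R :> R. Proof. by rewrite ler1n; apply: leq_trans b2. Qed.

Lemma measurable_affine_S (A : set R) (c k x : R) : measurable A ->
  measurable [set w | A (c + k * Sw x w)].
Proof.
move=> mA.
have mf : measurable_fun [set: R] (fun w : R => c + k * Sw x w).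
  apply: measurable_funD; first exact: measurable_cst.
  apply: measurable_funM; first exact: measurable_cst.
  exact: (measurable_S_fun b gamma01 phi_bound phi_lip).
by have := mf measurableT _ mA; rewrite setTI.
Qed.

Lemma measurable_S (A : set R) (x : R) : measurable A -> measurable [set w | A (Sw x w)].
Proof.
move=> mA.
by have := measurable_S_fun b gamma01 phi_bound phi_lip x measurableT mA; rewrite setTI.
Qed.

(** Conditioning on the first base-[b] digit: the cell of digit [d] is the image of [0, 1) under an
    affine map of ratio 1/b. *)
Lemma pr_affine (E : set R) : measurable E ->
  pr E = b%:R^-1 * \sum_(d < b) pr [set w | E ((d%:R + w) / b%:R)].
Proof.
move=> mE.
have mg l := measurable_absz_floor l (ltW bpos).
have fl (d : 'I_b) w : unit01 ((d%:R + w) / b%:R) /\ `|Num.floor ((d%:R + w) / b%:R * b%:R)|%N = d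
    <-> unit01 (w : R).
  rewrite divfK ?gt_eqF //; split.
    move=> [/andP[u1 _] e]; have u2 : 0 <= d%:R + w by rewrite ler_pdivlMr // mul0r in u1.
    have := floor_itv (d%:R + w).
    have f0 : 0 <= Num.floor (d%:R + w) by rewrite floor_ge0.
    have : Num.floor (d%:R + w) = d%:Z by rewrite -(gez0_abs f0) e.
    move=> ->; rewrite intrD -!pmulrn /unit01 /= => /andP[h1 h2]; apply/andP; split; lra.
  move=> /andP[w0 w1].
  have -> : Num.floor (d%:R + w) = d%:Z.
    by apply: floor_def; rewrite intrD -!pmulrn; apply/andP; split; lra.
  split => //; apply/andP; split; first by rewrite divr_ge0 // addr_ge0.
  rewrite ltr_pdivrMr // mul1r; have := ltn_ord d; rewrite -(ler_nat R) -natr1; lra.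
have gn (w : R) : unit01 w -> (`|Num.floor (w * b%:R)| < b)%N.
  move=> /andP[w0 w1].
  have f0 : 0 <= Num.floor (w * b%:R) by rewrite floor_ge0 mulr_ge0 // ltW.
  rewrite -(ltr_nat R) -[X in X < _](_ : (Num.floor (w * b%:R))%:~R = _); last first.
    by rewrite -{1}(gez0_abs f0) -pmulrn.
  apply: le_lt_trans (floor_le _) _; rewrite gtr_pMl //.
rewrite (pr_partition mg gn mE) mulr_sumr; apply: eq_bigr => d _.
have mI : measurable (@unit01 R `&` (E `&` [set w | `|Num.floor (w * b%:R)|%N = d])).
  apply: measurableI; first exact: measurable_unit01.
  exact: measurableI.
rewrite /pr (lebesgue_affine d%:R bpos mI).
rewrite (_ : [set w | _] = @unit01 R `&` [set w | E ((d%:R + w) / b%:R)]); last first.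
  apply/seteqP; split => w /=.
    by move=> [u [Ew e]]; split => //; exact: (fl d w).1 (conj u e).
  by move=> [/(fl d w).2[u e] Ew].
have mE' : measurable [set w : R | E ((d%:R + w) / b%:R)].
  have mf : measurable_fun [set: R] (fun w : R => (d%:R + w) / b%:R).
    apply: measurable_funM; last exact: measurable_cst.
    by apply: measurable_funD.
  by have := mf measurableT _ mE; rewrite setTI.
have := uniform01_fin mE'; rewrite /uniform01 /mrestr setIC => /fineK <-.
by rewrite -EFinM.
Qed.

(** The first [p] terms of the series at [x], for the word whose letters are the base-[b] digits of
    [t], least significant first. *)
Fixpoint offset (p : nat) (x : R) (t : nat) : R :=
  if p is p'.+1 then
    phi ((x + (t %% b)%:R) / b%:R) + gamma * offset p' ((x + (t %% b)%:R) / b%:R) (t %/ b)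
  else 0.

(** The value of S at [x] on the word coded by [t] followed by the digits of [w]: a copy of [m_y],
    [y = (x + t) / b^p], scaled by [gamma ^ p]. *)
Definition piece (p : nat) (x : R) (t : nat) (w : R) : R :=
  offset p x t + gamma ^+ p * Sw ((x + t%:R) / b%:R ^+ p) w.

Lemma pr_selfsimilar (p : nat) (x : R) (A : set R) : measurable A ->
  pr [set w | A (Sw x w)] = (b%:R ^+ p)^-1 * \sum_(t < b ^ p) pr [set w | A (piece p x t w)].
Proof.
elim: p x A => [|p IH] x A mA.
  rewrite expr0 invr1 mul1r expn0 big_ord1; apply: pr_ext => w _.
  by rewrite /piece /= addr0 add0r !expr0 mul1r divr1.
rewrite (pr_affine (measurable_S x mA)) exprS invfM -mulrA; congr (_ * _).
(* The index is [t * b + d]: the letter [d] read first is the least significant digit. *)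
rewrite expnSr (sum_ord_mul (b ^ p) b (fun s => pr [set w | A (piece p.+1 x s w)])).
rewrite exchange_big mulr_sumr; apply: eq_bigr => d _ /=.
set y := (x + d%:R) / b%:R.
have mA' : measurable [set v | A (phi y + gamma * v)].
  have mf : measurable_fun [set: R] (fun v : R => phi y + gamma * v).
    apply: measurable_funD; first exact: measurable_cst.
    by apply: measurable_funM.
  by have := mf measurableT _ mA; rewrite setTI.
transitivity (pr [set w | [set v | A (phi y + gamma * v)] (Sw y w)]).
  apply: pr_ext => w u /=; rewrite (S_fun_affine b2 gamma01 phi_bound) //.
rewrite (IH _ _ mA'); congr (_ * _); apply: eq_bigr => t _; apply: pr_ext => w _ /=.
rewrite /piece /= modnMDl modn_small // divnMDl ?(leq_trans _ b2) // divn_small // addn0.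
rewrite -/y mulrDr addrA exprS mulrA [b%:R ^+ p.+1]exprS.
rewrite (_ : (x + (t * b + d)%N%:R) / (b%:R * b%:R ^+ p) = (y + t%:R) / b%:R ^+ p) //.
rewrite natrD natrM /y; field.
by rewrite gt_eqF //= gt_eqF.
Qed.

(** [B / (1 - gamma)] is the fixed point of [C = B + gamma * C]. The second summand leaves room for
    the whole piece. *)
Lemma offset_bound p x t : `|offset p x t| + gamma ^+ p * (B / (1 - gamma)) <= B / (1 - gamma).
Proof.
elim: p x t => [|p IH] x t /=; first by rewrite normr0 add0r expr0 mul1r.
set y := (x + _) / _; set t' := (_ %/ _)%N.
have h1 := ler_normD (phi y) (gamma * offset p y t').
rewrite normrM (gtr0_norm g0) in h1.
have h2 := phi_bound y.
have h3 := ler_wpM2l (ltW g0) (IH y t').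
have e : B / (1 - gamma) = B + gamma * (B / (1 - gamma)).
  by field; rewrite subr_eq0 eq_sym lt_eqF.
rewrite exprS; move: h3; rewrite mulrDr mulrA => h3; lra.
Qed.

Lemma piece_bound p x t w : `|piece p x t w| < D%:R.
Proof.
apply: le_lt_trans D_large; apply: le_trans (offset_bound p x t).
apply: le_trans (ler_normD _ _) _; rewrite lerD2l normrM ger0_norm ?exprn_ge0 ?(ltW g0) //.
rewrite ler_pM2l ?exprn_gt0 //.
exact: (S_fun_bound b gamma01 phi_bound).
Qed.

(** * Atoms of the partitions and the entropy [H] *)

Lemma S_bound x w : `|Sw x w| < D%:R.
Proof. exact: le_lt_trans (S_fun_bound b gamma01 phi_bound _ _) D_large. Qed.

(** Number of the [L_i]-atom of [y], shifted by [D * b ^ i] to be a natural number on (-D, D). As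
    [D] is an integer, the atoms are those of [L_i]. *)
Definition idx (i : nat) (y : R) : nat := `|Num.floor ((y + D%:R) * b%:R ^+ i)|%N.

Definition width (i : nat) : nat := (2 * D * b ^ i)%N.

Lemma idx_itv i y : `|y| < D%:R ->
  (idx i y)%:R <= (y + D%:R) * b%:R ^+ i < (idx i y)%:R + 1.
Proof.
rewrite ltr_norml => /andP[y1 y2].
have f0 : 0 <= Num.floor ((y + D%:R) * b%:R ^+ i).
  rewrite floor_ge0 mulr_ge0 ?(ltW (bXpos i)) //; lra.
have e : (Num.floor ((y + D%:R) * b%:R ^+ i))%:~R = (idx i y)%:R :> R.
  by rewrite -{1}(gez0_abs f0) -pmulrn.
by have := floor_itv ((y + D%:R) * b%:R ^+ i); rewrite intrD e.
Qed.

Lemma idx_def i y l : l%:R <= (y + D%:R) * b%:R ^+ i < l%:R + 1 -> idx i y = l.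
Proof.
by move=> h; rewrite /idx (@floor_def _ _ l%:Z) // intrD -!pmulrn.
Qed.

Lemma idx_lt i y : `|y| < D%:R -> (idx i y < width i)%N.
Proof.
move=> yD; have /andP[h _] := idx_itv i yD; rewrite -(ltr_nat R).
apply: le_lt_trans h _; rewrite /width natrM natrX ltr_pM2r //.
move: yD; rewrite ltr_norml natrM => /andP[y1 y2]; lra.
Qed.

Lemma idx_refine i m y : `|y| < D%:R -> (idx (i + m) y %/ b ^ m = idx i y)%N.
Proof.
move=> yD; have /andP[h1 h2] := idx_itv (i + m) yD; apply/esym/idx_def.
have bm : (0 < b ^ m)%N by rewrite expn_gt0 (leq_trans _ b2).
set n := idx _ _ in h1 h2 *.
have e := divn_eq n (b ^ m).
have r : (n %% b ^ m < b ^ m)%N by rewrite ltn_mod.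
rewrite exprD mulrA in h1 h2.
have bX := bXpos m.
rewrite -(ler_pM2r bX) -(ltr_pM2r bX); apply/andP; split.
  apply: le_trans h1; rewrite -natrX -natrM ler_nat; exact: leq_divM.
apply: lt_le_trans h2 _.
by rewrite !natr1 -natrX -natrM ler_nat ltn_ceil.
Qed.

Lemma idx_close i y y' r c : `|y| < D%:R -> `|y'| < D%:R ->
  (y - y') * b%:R ^+ i <= r -> r + 1 <= c%:R -> (idx i y < idx i y' + c)%N.
Proof.
move=> yD yD' h rc.
have /andP[h1 _] := idx_itv i yD; have /andP[_ h2] := idx_itv i yD'.
rewrite -(ltr_nat R) natrD.
move: h; rewrite mulrBl; move: h1 h2; rewrite !mulrDl; lra.
Qed.

Lemma measurable_idx i l : measurable [set y | idx i y = l].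
Proof.
have mf : measurable_fun [set: R] (fun y : R => y + D%:R) by apply: measurable_funD.
by have := mf measurableT _ (measurable_absz_floor l (ltW (bXpos i))); rewrite setTI.
Qed.

Definition q (x : R) (i l : nat) : R := pr [set w | idx i (Sw x w) = l].

Definition H (x : R) (i : nat) : R := \sum_(l < width i) xent (q x i l).

Lemma measurable_idx_S x i l : measurable [set w | idx i (Sw x w) = l].
Proof. exact: (measurable_S x (measurable_idx i l)). Qed.

Lemma q_ge0 x i l : 0 <= q x i l. Proof. exact: pr_ge0. Qed.

Lemma q_le1 x i l : q x i l <= 1.
Proof. exact: pr_le1 (measurable_idx_S x i l). Qed.

Lemma H_ge0 x i : 0 <= H x i.
Proof. by apply: sumr_ge0 => l _; rewrite xent_ge0 ?q_le1 ?q_ge0. Qed.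

Lemma sum_q x i : \sum_(l < width i) q x i l = 1.
Proof. by apply: sum_pr => [l|w _]; [exact: measurable_idx_S|exact: idx_lt (S_bound x w)]. Qed.

Lemma sum_q_pred x i (P : pred nat) :
  pr [set w | P (idx i (Sw x w))] = \sum_(l < width i | P l) q x i l.
Proof.
have mP : measurable [set w | P (idx i (Sw x w))].
  exact: (measurable_pred_nat (measurable_idx_S x i) P).
rewrite (pr_partition (measurable_idx_S x i) (n := width i)) //; last first.
  by move=> w _; exact: idx_lt (S_bound x w).
rewrite [RHS]big_mkcond /=; apply: eq_bigr => l _; case: ifP => Pl.
  by apply: pr_ext => w _ /=; split => [[]//|e]; rewrite e.
by apply: pr_empty => w _ /= [Pw e]; rewrite e Pl in Pw.
Qed.

Lemma refine_eq i m l l' y : `|y| < D%:R -> (l' < b ^ m)%N ->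
  idx (i + m) y = (l * b ^ m + l')%N -> idx i y = l.
Proof.
move=> yD lm e; rewrite -(idx_refine i m yD) e divnMDl ?divn_small ?addn0 //.
by rewrite expn_gt0 (leq_trans _ b2).
Qed.

(* Stated for an arbitrary random variable [v], so as to cover both [S] and its pieces. *)
Lemma pr_refine (v : R -> R) i m l : (forall w, `|v w| < D%:R) ->
  (forall k j, measurable [set w | idx k (v w) = j]) ->
  \sum_(l' < b ^ m) pr [set w | idx (i + m) (v w) = (l * b ^ m + l')%N] =
  pr [set w | idx i (v w) = l].
Proof.
move=> vD mv; pose g w := (idx (i + m) (v w) %% b ^ m)%N.
have bm : (0 < b ^ m)%N by rewrite expn_gt0 (leq_trans _ b2).
have mg j : measurable [set w | g w = j].
  exact: (measurable_pred_nat (mv (i + m)%N) (fun n => n %% b ^ m = j)%N).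
rewrite (pr_partition mg (n := (b ^ m)%N)) //; last by move=> w _; rewrite /g ltn_mod.
apply: eq_bigr => l' _; apply: pr_ext => w _ /=; split.
  move=> e; split; first exact: refine_eq (vD w) (ltn_ord l') e.
  by rewrite /g e modnMDl modn_small.
by move=> [e1 e2]; rewrite (divn_eq (idx (i + m) (v w)) (b ^ m)) idx_refine // e1 -/(g w) e2.
Qed.

Lemma width_add i m : width (i + m) = (width i * b ^ m)%N.
Proof. by rewrite /width expnD mulnA. Qed.

Lemma H_add x i m : H x (i + m) <= H x i + m%:R * ln b%:R.
Proof.
rewrite /H width_add (sum_ord_mul (width i) (b ^ m) (fun s => xent (q x (i + m) s))).
rewrite -[m%:R * _]mul1r -[X in X * (_ * _)](sum_q x i) mulr_suml -big_split /=; apply: ler_sum => l _.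
have h := @xent_sum_card R _ (fun l' : 'I_(b ^ m) => q x (i + m) (l * b ^ m + l')%N) [set: 'I__]%SET (b ^ m).
rewrite pr_refine in h; [|exact: S_bound|exact: measurable_idx_S].
have -> : m%:R * ln b%:R = ln (b ^ m)%:R :> R by rewrite natrX lnXn // mulr_natl.
apply: h; first by move=> ?; exact: q_ge0.
  by move=> ?; rewrite inE.
by rewrite cardsT card_ord.
Qed.

(** [Sw x w] and [Sw y w] are at most one atom length apart, so their indices differ by at most 1,
    and the index of one leaves a window of 3 values for the other. *)
Lemma H_robust x y m : L / (1 - gamma) * `|x - y| * b%:R ^+ m <= 1 ->
  H x m <= H y m + ln 3%:R.
Proof.
move=> h; apply: entropy_spread; try exact: measurable_idx_S;
  try by move=> w _; exact: idx_lt (S_bound _ w).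
move=> w w' _ _ e.
have cl z v v' : `|v - v'| = `|x - y| -> 
   (Sw v z - Sw v' z) * b%:R ^+ m <= 1.
  move=> vv; apply: le_trans h; rewrite ler_pM2r //.
  apply: le_trans (ler_norm _) _; rewrite -vv.
  exact: (S_fun_lipschitz b2 gamma01 phi_bound phi_lip).
have c1 := idx_close (c := 2) (S_bound x w) (S_bound y w) (cl w x y erefl).
have c2 := idx_close (c := 2) (S_bound y w') (S_bound x w') (cl w' y x (distrC _ _)).
have := c1 _; have := c2 _; rewrite e.
by rewrite (_ : 1 + 1 = 2%:R) // => /(_ (lexx _)) h2 /(_ (lexx _)) h1; lia.
Qed.

Lemma natpow_gt (X : R) : exists M, forall m, (M <= m)%N -> X < b%:R ^+ m.
Proof.
exists (Num.bound `|X|) => m hm.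
apply: le_lt_trans (ler_norm X) _; apply: lt_le_trans (archi_boundP (normr_ge0 X)) _.
rewrite -natrX ler_nat; apply: leq_trans hm _; exact: ltnW (ltn_expl _ b2).
Qed.

Let lnb0 : 0 < ln b%:R :> R.
Proof. by apply: ln_gt0; rewrite ltr1n. Qed.

Lemma linear_ge (c C : R) : 0 < c -> exists M, forall m, (M <= m)%N -> C <= c * (m%:R * ln b%:R).
Proof.
move=> c0; exists (Num.bound `|C / (c * ln b%:R)|) => m hm.
have h := archi_boundP (normr_ge0 (C / (c * ln b%:R))).
have h2 : C / (c * ln b%:R) <= m%:R.
  by apply: le_trans (ler_norm _) _; apply: le_trans (ltW h) _; rewrite ler_nat.
by rewrite ler_pdivrMr ?mulr_gt0 // in h2; rewrite mulrCA.
Qed.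

Lemma m_xE x (A : set R) : m_x b gamma phi x A = pr [set w | A (Sw x w)].
Proof. by []. Qed.

(** * From exact dimensionality to entropy *)

Definition rad (m : nat) : R := 2%:R / b%:R ^+ m.

Lemma ln_rad m : ln (rad m) = ln 2%:R - m%:R * ln b%:R.
Proof. by rewrite /rad ln_div ?posrE ?exprn_gt0 // lnXn // mulr_natl. Qed.

Definition nbr (l l' : nat) : bool := (l' <= l + 2)%N && (l <= l' + 2)%N.

Lemma nbr_refl l : nbr l l.
Proof. by rewrite /nbr leq_addr. Qed.

Definition nbr_mass (x : R) (m l : nat) : R := \sum_(l' < width m | nbr l l') q x m l'.

(* For an exact dimensional measure, [r ^ (alpha + e) <= mu (ball y r) <= r ^ (alpha - e)]
   with [r = 2 b^-m], where the atom of [y] is inside the ball and the ball is inside the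
   five neighbouring atoms. *)
Definition good_atom (alpha e x : R) (m l : nat) : bool :=
  (q x m l == 0) || ((ln (q x m l) <= (alpha - e) * ln (rad m)) &&
                     ((alpha + e) * ln (rad m) <= ln (nbr_mass x m l))).

Lemma idx_ball_in m y y' : `|y| < D%:R -> `|y'| < D%:R -> idx m y = idx m y' ->
  `|y - y'| < rad m.
Proof.
move=> yD yD' e; have := idx_itv m yD; have := idx_itv m yD'; rewrite e => /andP[h1 h2] /andP[h3 h4].
rewrite /rad ltr_pdivlMr // -[X in _ * X](@gtr0_norm _ (b%:R ^+ m)) // -normrM mulrBl.
rewrite !mulrDl in h1 h2 h3 h4; rewrite ltr_norml; apply/andP; split; lra.
Qed.

Lemma idx_ball_out m y y' : `|y| < D%:R -> `|y'| < D%:R -> `|y - y'| < rad m ->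
  nbr (idx m y) (idx m y').
Proof.
move=> yD yD' h.
have hb z : `|z| < rad m -> z * b%:R ^+ m <= 2%:R.
  by move=> hz; rewrite -ler_pdivlMr //; apply: le_trans (ler_norm _) (ltW hz).
have c1 := @idx_close m y y' 2 3 yD yD' (hb _ h).
rewrite distrC in h; have c2 := @idx_close m y' y 2 3 yD' yD (hb _ h).
have e3 : 2%:R + 1 <= 3%:R :> R by rewrite natr1.
move: (c1 e3) (c2 e3); rewrite !(addnS _ 2) !ltnS => l1 l2.
by rewrite /nbr l2 l1.
Qed.

(** At almost every point the quotient of logarithms at radius [rad m] is eventually within [e] of
    [alpha], and [pr_limsup0] turns this into smallness of the bad mass. Since [ln (rad m) < 0],
    clearing the denominator reverses the inequalities. *)
Lemma exact_atoms (alpha x : R) : exact_dimensional (m_x b gamma phi x) alpha ->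
  forall e e' : R, 0 < e -> 0 < e' -> exists m0, forall m, (m0 <= m)%N ->
  pr [set w | ~~ good_atom alpha e x m (idx m (Sw x w))] <= e'.
Proof.
move=> [N [mN [N0 cv]]] e e' e0 e'0.
apply: (@pr_limsup0 _ (fun m => [set w | ~~ good_atom alpha e x m (idx m (Sw x w))])
  [set w | N (Sw x w)]) => //.
- move=> m; exact: (measurable_pred_nat (measurable_idx_S x m) (fun l => ~~ good_atom alpha e x m l)).
- exact: measurable_S.
move=> w u nN; set y := Sw x w.
have /cvgrPdist_lt /(_ e e0) := cv y nN.
rewrite near_withinE => /nbhs_ballP[d /= d0 hd].
have [M1 hM1] := natpow_gt (2%:R / d); have [M2 hM2] := natpow_gt 2%:R.
exists (maxn M1 M2) => m; rewrite geq_max => /andP[/hM1 h1 /hM2 h2].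
rewrite /good_atom; case: eqP => // /eqP q0 /=.
have r0 : 0 < rad m by rewrite divr_gt0.
have rd : rad m < d by rewrite /rad ltr_pdivrMr // mulrC -ltr_pdivrMr.
have r1 : rad m < 1 by rewrite /rad ltr_pdivrMr // mul1r.
have lr : ln (rad m) < 0 by rewrite ln_lt0 // r0.
have := hd (rad m); rewrite /ball /= sub0r normrN (gtr0_norm r0) => /(_ rd r0).
set beta := m_x _ _ _ _ _ => hb.
have mball : measurable [set z : R | ball y (rad m) z] by exact: measurable_ball.
have qb : q x m (idx m y) <= beta.
  rewrite /beta m_xE; apply: pr_le; [exact: measurable_idx_S|exact: (measurable_S x mball)|].
  move=> w' _ /= e1; rewrite /ball /=; apply: idx_ball_in; [exact: S_bound|exact: S_bound|].
  by rewrite e1.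
have bs : beta <= nbr_mass x m (idx m y).
  rewrite /beta m_xE /nbr_mass -sum_q_pred; apply: pr_le; first exact: (measurable_S x mball).
    exact: (measurable_pred_nat (measurable_idx_S x m) (nbr (idx m y))).
  by move=> w' _ /=; rewrite /ball /=; apply: idx_ball_out; exact: S_bound.
have qp : 0 < q x m (idx m y) by rewrite lt_neqAle eq_sym q0 q_ge0.
have bp := lt_le_trans qp qb; have sp := lt_le_trans bp bs.
move: hb; rewrite ltr_norml => /andP[hb1 hb2].
have k1 : (alpha - e) * ln (rad m) >= ln beta.
  have : alpha - e <= ln beta / ln (rad m) by lra.
  by rewrite ler_ndivlMr.
have k2 : (alpha + e) * ln (rad m) <= ln beta.
  have : ln beta / ln (rad m) <= alpha + e by lra.
  by rewrite ler_ndivrMr.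
apply/negP; rewrite negbK; apply/andP; split.
  by apply: le_trans k1; rewrite ler_ln ?posrE.
by apply: (le_trans k2); rewrite ler_ln ?posrE.
Qed.

Lemma card_nbr m l : (#|[set l' : 'I_(width m) | nbr l l']%SET| <= 5)%N.
Proof.
by apply: card_ord_spread => i j; rewrite !inE /nbr; lia.
Qed.

Lemma sum_nbr_mass x m : \sum_(l < width m) nbr_mass x m l <= 5%:R.
Proof.
rewrite /nbr_mass.
under eq_bigr => l _ do rewrite big_mkcond.
rewrite exchange_big /= -[leRHS]mulr1 -[X in _ * X](sum_q x m) mulr_sumr; apply: ler_sum => l' _.
rewrite -big_mkcond /= sumr_const -[leLHS]mulr_natl ler_wpM2r ?q_ge0 // ler_nat.
apply: leq_trans (card_nbr m l'); rewrite leq_eqVlt; apply/orP; left; apply/eqP.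
by apply: eq_card => l; rewrite !inE /nbr andbC.
Qed.

Lemma D_gt0 : (0 < D)%N.
Proof. by rewrite -(ltr0n R); apply: le_lt_trans (S_bound 0 0). Qed.

Lemma width_gt0 m : (0 < width m)%N.
Proof. by rewrite /width muln_gt0 expn_gt0 (leq_trans _ b2) // muln_gt0 D_gt0. Qed.

Lemma H_atoms_lower (alpha e x : R) m (p := pr [set w | ~~ good_atom alpha e x m (idx m (Sw x w))]) :
  (1 - p) * - ((alpha - e) * ln (rad m)) <= H x m.
Proof.
rewrite /p (sum_q_pred x m (fun l => ~~ good_atom alpha e x m l)).
rewrite -(sum_q x m) [X in X - _](bigID (fun l : 'I__ => ~~ good_atom alpha e x m l)) /=.
rewrite addrAC subrr add0r mulr_suml /H.
rewrite [leRHS](bigID (fun l : 'I__ => ~~ good_atom alpha e x m l)) /= -[leLHS]add0r lerD //.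
  by apply: sumr_ge0 => l _; rewrite xent_ge0 ?q_le1 ?q_ge0.
apply: ler_sum => l; rewrite negbK /good_atom => /orP[/eqP->|/andP[h _]].
  by rewrite mul0r xent0.
by rewrite /xent -[leRHS]mulrN ler_wpM2l ?q_ge0 // lerN2.
Qed.

(** Exact dimensionality bounds from below only the mass of five neighbouring atoms, not that of one
    atom. Hence Gibbs with weights [T]: half neighbour mass over 5, which serves the good atoms, and
    half uniform mass, which serves the bad ones. Their sum is at most 1, as each atom is counted in
    at most five neighbourhoods. *)
Lemma H_atoms_upper (alpha e x : R) m (p := pr [set w | ~~ good_atom alpha e x m (idx m (Sw x w))]) :
  H x m <= (1 - p) * (ln 10%:R - (alpha + e) * ln (rad m)) + p * (ln (4 * D)%:R + m%:R * ln b%:R).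
Proof.
have wpos : 0 < (width m)%:R :> R by rewrite ltr0n width_gt0.
have s0 l : 0 <= nbr_mass x m l by apply: sumr_ge0 => l' _; exact: q_ge0.
pose T (l : 'I_(width m)) := nbr_mass x m l / 10%:R + 1 / (2%:R * (width m)%:R).
have wi : 0 < 1 / (2%:R * (width m)%:R) :> R by rewrite divr_gt0 // mulr_gt0.
have T0 l : 0 < T l by rewrite /T ltr_wpDl // divr_ge0.
apply: le_trans (gibbs_sum (T := T) (fun l => q_ge0 x m l) _ _) _.
- by move=> l; exact: ltW.
- by move=> l /eqP; rewrite gt_eqF.
have sT : \sum_l T l <= 1.
  rewrite big_split /= -mulr_suml sumr_const card_ord -[X in _ + X]mulr_natl.
  have := sum_nbr_mass x m => h.
  have -> : (width m)%:R * (1 / (2%:R * (width m)%:R)) = 2%:R^-1 :> R.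
    by field; rewrite gt_eqF.
  lra.
have key : - (\sum_(l < width m) q x m l * ln (T l)) <=
   (1 - p) * (ln 10%:R - (alpha + e) * ln (rad m)) + p * (ln (4 * D)%:R + m%:R * ln b%:R).
  rewrite /p (sum_q_pred x m (fun l => ~~ good_atom alpha e x m l)).
  rewrite -[X in (X - _) * _](sum_q x m) [X in X - _](bigID (fun l : 'I__ => ~~ good_atom alpha e x m l)) /=.
  rewrite [X in X - _]addrC addrK !mulr_suml -sumrN.
  rewrite [leLHS](bigID (fun l : 'I__ => ~~ good_atom alpha e x m l)) /= addrC; apply: lerD.
    apply: ler_sum => l; rewrite negbK /good_atom => /orP[/eqP->|/andP[_ h]].
      by rewrite !mul0r oppr0.
    have [->|qn] := eqVneq (q x m l) 0; first by rewrite !mul0r oppr0.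
    rewrite -mulrN ler_wpM2l ?q_ge0 //.
    have sp : 0 < nbr_mass x m l.
      apply: (@lt_le_trans _ _ (q x m l)); first by rewrite lt_neqAle eq_sym qn q_ge0.
      rewrite /nbr_mass (bigD1 l) /=; last exact: nbr_refl.
      by rewrite lerDl sumr_ge0 // => l' _; exact: q_ge0.
    have : ln (nbr_mass x m l / 10%:R) <= ln (T l).
      by rewrite ler_ln ?posrE ?divr_gt0 // /T lerDl ltW.
    rewrite ln_div ?posrE //; lra.
  apply: ler_sum => l _; rewrite -mulrN ler_wpM2l ?q_ge0 //.
  have : ln (1 / (2%:R * (width m)%:R)) <= ln (T l).
    by rewrite ler_ln ?posrE // /T lerDr divr_ge0.
  rewrite ln_div ?posrE ?mulr_gt0 // ln1 -natrM (_ : (2 * width m)%N = (4 * D * b ^ m)%N); last first.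
    by rewrite /width !mulnA.
  rewrite natrM lnM ?posrE ?natrX ?ltr0n ?muln_gt0 ?D_gt0 // lnXn // -mulr_natl; lra.
rewrite (sum_q x m); lra.
Qed.

Lemma exact_entropy (alpha x : R) : exact_dimensional (m_x b gamma phi x) alpha ->
  forall e : R, 0 < e -> exists m0, forall m, (m0 <= m)%N ->
  `|H x m - alpha * (m%:R * ln b%:R)| <= e * (m%:R * ln b%:R).
Proof.
move=> ex e e0.
(* Bad atoms of mass [p] affect the bounds by [p] times a multiple of [m * ln b]; [e'] makes this a
   fraction of [e], and [C] collects what stays bounded in [m]. The absolute value is there because
   [alpha_ge0] is itself deduced from this lemma. *)
have a0 : 0 < 4%:R * (`|alpha| + e + 2%:R) by rewrite mulr_gt0 // ltr_wpDl // addr_ge0 // ltW.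
pose e' := Num.min 1 (e / (4%:R * (`|alpha| + e + 2%:R))).
have e'0 : 0 < e' by rewrite /e' lt_min ltr01 divr_gt0.
have [m0 hm0] := exact_atoms ex (divr_gt0 e0 (ltr0n R 4)) e'0.
pose C := ln 10%:R + (`|alpha| + e) * ln 2%:R + ln (4 * D)%:R : R.
have e4 : 0 < e / 8%:R by rewrite divr_gt0.
have [m1 hm1] := linear_ge C e4.
exists (maxn m0 m1) => m; rewrite geq_max => /andP[/hm0 hp /hm1].
have := H_atoms_lower (alpha) (e / 4%:R) x m; have := H_atoms_upper (alpha) (e / 4%:R) x m.
have := pr_ge0 [set w | ~~ good_atom alpha (e / 4%:R) x m (idx m (Sw x w))].
have := H_ge0 x m.
rewrite ln_rad; set p := pr _ in hp *; set t := m%:R * _.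
have t0 : 0 <= t by rewrite mulr_ge0 // ltW.
have l2 : 0 <= ln 2%:R :> R by apply: ln_ge0; rewrite ler1n.
have l10 : 0 <= ln 10%:R :> R by apply: ln_ge0; rewrite ler1n.
have lD : 0 <= ln (4 * D)%:R :> R by apply: ln_ge0; rewrite ler1n muln_gt0 D_gt0.
have p1 : p <= 1 by apply: le_trans hp _; rewrite /e' ge_min lexx.
have pe : p * (4%:R * (`|alpha| + e + 2%:R)) <= e.
  rewrite -ler_pdivlMr //; apply: le_trans hp _; by rewrite /e' ge_min lexx orbT.
move=> H0 p0 hup hlow; rewrite /C; move: hup hlow; rewrite /=.
clear C hm1; move: (ln 2%:R) (ln 10%:R) (ln (4 * D)%:R) l2 l10 lD => l2 l10 lD l20 l100 lD0 hup hlow hC.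
have pet : p * (4%:R * (`|alpha| + e + 2%:R)) * t <= e * t by rewrite ler_wpM2r.
have an := normr_ge0 alpha.
have pt : 0 <= p * t by rewrite mulr_ge0.
have pl : 0 <= p * l2 by rewrite mulr_ge0.
have pl2 : p * l2 <= l2 by rewrite ler_piMl.
have plD : p * lD <= lD by rewrite ler_piMl.
have pl10 : 0 <= p * l10 by rewrite mulr_ge0.
have bd s : 0 <= s -> - (`|alpha| * s) <= alpha * s <= `|alpha| * s.
  by move=> s0; rewrite -ler_norml normrM (ger0_norm s0).
have /andP[b1 b1'] := bd _ pt; have /andP[_ b2'] := bd _ pl; have /andP[b3 b3'] := bd _ l20.
have b4 : `|alpha| * (p * l2) <= `|alpha| * l2 by rewrite ler_wpM2l.
have b5 : e * (p * l2) <= e * l2 by rewrite ler_pM2l.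
have b6 : 0 <= e * (p * t) by rewrite mulr_ge0 // ltW.
have b7 : 0 <= e * t by rewrite mulr_ge0 // ltW.
have b8 : 0 <= e * l2 by rewrite mulr_ge0 // ltW.
have b9 : 0 <= `|alpha| * l2 by rewrite mulr_ge0.
rewrite ler_norml; apply/andP; split; last by lra.
(* For [alpha <= e / 4] the lower estimate follows from [H >= 0] alone; otherwise the factor
   [alpha - e / 4] is positive and [H_atoms_lower] can be used. *)
have [ae|ea] := leP alpha (e / 4%:R).
  have : alpha * t <= e / 4%:R * t by rewrite ler_wpM2r.
  lra.
have s0 : 0 <= alpha - e / 4%:R by lra.
have c1 : 0 <= (alpha - e / 4%:R) * (p * l2) by rewrite mulr_ge0.
lra.
Qed.

(** A good atom has mass at most [rad m] to the power [alpha / 2]; a bad one has at most the total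
    bad mass. *)
Lemma exact_atoms_small (alpha x : R) : 0 < alpha -> exact_dimensional (m_x b gamma phi x) alpha ->
  forall e : R, 0 < e -> exists m, forall l, q x m l <= e.
Proof.
move=> a0 ex e e0.
have a2 : 0 < alpha / 2%:R by rewrite divr_gt0.
have [m0 hm0] := exact_atoms ex a2 e0.
have [m1 hm1] := linear_ge (alpha / 2%:R * ln 2%:R - ln e) a2.
exists (maxn m0 m1) => l.
have /hm0 h0 := leq_maxl m0 m1; have /hm1 h1 := leq_maxr m0 m1.
set m := maxn m0 m1 in h0 h1 *.
have [g|ng] := boolP (good_atom alpha (alpha / 2%:R) x m l); last first.
  apply: le_trans h0; apply: pr_le; first exact: measurable_idx_S.
    exact: (measurable_pred_nat (measurable_idx_S x m) (fun l => ~~ good_atom alpha (alpha / 2%:R) x m l)).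
  by move=> w _ /= ->.
case/orP: g => [/eqP->|/andP[h _]]; first exact: ltW.
have := q_ge0 x m l; rewrite le0r => /orP[/eqP->|qp]; first exact: ltW.
rewrite -ler_ln ?posrE //; apply: le_trans h _; rewrite ln_rad mulrBr.
have -> : alpha - alpha / 2%:R = alpha / 2%:R by field.
lra.
Qed.

(** * From almost every point to grid points *)

Lemma expn_lt (s e : R) : 0 <= s < 1 -> 0 < e -> exists n, forall k, (n <= k)%N -> s ^+ k < e.
Proof.
move=> /andP[s0 s1] e0.
have cv : s ^+ n @[n --> \oo] --> (0 : R) by apply: cvg_expr; rewrite ger0_norm.
by have [n _ hn] := cvgr_lt _ cv _ e0; exists n => k; exact: hn.
Qed.

Lemma absz_floor_itv (c w : R) : 0 <= w * c ->
  `|Num.floor (w * c)|%N%:R <= w * c < `|Num.floor (w * c)|%N%:R + 1.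
Proof.
move=> c0; have f0 : 0 <= Num.floor (w * c) by rewrite floor_ge0.
have e : (Num.floor (w * c))%:~R = `|Num.floor (w * c)|%N%:R :> R.
  by rewrite -{1}(gez0_abs f0) -pmulrn.
by have := floor_itv (w * c); rewrite intrD e.
Qed.

Lemma absz_floor_lt p (w : R) : unit01 w -> (`|Num.floor (w * b%:R ^+ p)| < b ^ p)%N.
Proof.
move=> /andP[w0 w1]; have h : 0 <= w * b%:R ^+ p by rewrite mulr_ge0 // ltW.
have /andP[h1 _] := absz_floor_itv h.
by rewrite -(ltr_nat R); apply: le_lt_trans h1 _; rewrite natrX gtr_pMl.
Qed.

Lemma pr_cell p t : (t < b ^ p)%N ->
  pr [set w : R | `|Num.floor (w * b%:R ^+ p)|%N = t] = (b%:R ^+ p)^-1.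
Proof.
move=> tb; have bX := bXpos p; rewrite /pr.
have tb' : t%:R + 1 <= b%:R ^+ p :> R by rewrite natr1 -natrX ler_nat.
rewrite (_ : _ `&` _ = [set` `[t%:R / b%:R ^+ p, (t%:R + 1) / b%:R ^+ p[]).
  rewrite lebesgue_measure_itv /= lte_fin ltr_pM2r ?invr_gt0 // ltrDl ltr01.
  by rewrite EFinN -EFinB /= -mulrBl addrAC subrr add0r mul1r.
apply/seteqP; split => w /=; rewrite in_itv /= ler_pdivrMr // ltr_pdivlMr //.
  move=> [/andP[w0 w1] e]; have h : 0 <= w * b%:R ^+ p by rewrite mulr_ge0 // ltW.
  by have := absz_floor_itv h; rewrite e.
move=> /andP[h1 h2]; split.
  apply/andP; split; last by rewrite -(ltr_pM2r bX) mul1r; apply: lt_le_trans h2 _.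
  by rewrite -(ler_pM2r bX) mul0r; apply: le_trans h1.
by rewrite (@floor_def _ _ t%:Z) // intrD -!pmulrn h1.
Qed.

Definition deviates (alpha e : R) (m : nat) (y : R) : bool :=
  e * (m%:R * ln b%:R) < `|H y m - alpha * (m%:R * ln b%:R)|.

Definition lipS : R := L / (1 - gamma).

Lemma lipS_ge0 : 0 <= lipS.
Proof.
rewrite /lipS divr_ge0 // ?subr_ge0 ?(ltW g1) //.
by have := phi_lip 1 0; rewrite subr0 normr1 mulr1; apply: le_trans.
Qed.

Lemma H_robust_norm x y m : lipS * `|x - y| * b%:R ^+ m <= 1 -> `|H x m - H y m| <= ln 3%:R.
Proof.
move=> h; rewrite ler_norml; apply/andP; split.
  by rewrite lerNl opprB lerBlDl; apply: H_robust; rewrite distrC.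
by rewrite lerBlDl; exact: H_robust h.
Qed.

Variable alpha : R.
Hypothesis ae_exact : {ae (@lebesgue_measure R), forall x : R, 0 <= x <= 1 ->
      exact_dimensional (m_x b gamma phi x) alpha}.

Lemma ae_exactP : exists N : set R, [/\ measurable N, pr N = 0 &
  forall z, unit01 z -> ~ N z -> exact_dimensional (m_x b gamma phi z) alpha].
Proof.
have [N [mN N0 hN]] := ae_exact; exists N; split => //.
  have mI : measurable (@unit01 R `&` N) by apply: measurableI => //; exact: measurable_unit01.
  rewrite /pr (_ : lebesgue_measure _ = 0%E) //; apply/eqP.
  rewrite eq_le measure_ge0 andbT -N0; apply: le_measure; [by rewrite inE|by rewrite inE|by move=> w []].
move=> z /andP[z0 z1] nN; apply: contrapT => ne; apply: nN; apply: hN => /= h.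
by apply: ne; apply: h; rewrite z0 ltW.
Qed.

Lemma exact_point : exists x, exact_dimensional (m_x b gamma phi x) alpha /\ unit01 x.
Proof.
have [N [mN N0 hN]] := ae_exactP; apply: contrapT => h.
have h1 : pr N = 1.
  by apply: pr_full => w u; apply: contrapT => nw; apply: h; exists w; split => //; exact: hN.
by move/eqP: h1; rewrite N0 eq_sym oner_eq0.
Qed.

Lemma grid_point01 p (x : R) (t : 'I_(b ^ p)) : 0 <= x <= 1 -> 0 <= (x + t%:R) / b%:R ^+ p <= 1.
Proof.
move=> /andP[x0 x1].
rewrite divr_ge0 ?addr_ge0 ?(ltW (bXpos p)) //= ler_pdivrMr // mul1r -natrX.
by have := ltn_ord t; rewrite -(ler_nat R) -natr1; lra.
Qed.

(** A grid point deviating by [e] forces its whole cell of length b^-p into the set [A m] of points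
    deviating by [e / 3] after rounding, because [H] moves by at most [ln 3 <= e / 6 * (m * ln b)].
    Summing over cells, the number of deviating points times b^-p is at most [pr (A m) <= e]. *)
Lemma grid_entropy (e : R) : 0 < e -> exists m0, forall m, (m0 <= m)%N ->
  exists p0, forall p, (p0 <= p)%N -> forall x, 0 <= x <= 1 ->
  #|[set t : 'I_(b ^ p) | deviates alpha e m ((x + t%:R) / b%:R ^+ p)]%SET|%:R <= e * b%:R ^+ p.
Proof.
move=> e0; have two (X : R) : 2%:R / X = 1 / X + 1 / X by rewrite -mulrDl.
have e663 : e / 6%:R + e / 6%:R = e / 3%:R by field.
have e631 : e / 6%:R + e / 3%:R <= e by lra.
have [N [mN N0 hN]] := ae_exactP.
have [c0 hc0] := natpow_gt (lipS * 2%:R).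
have e6 : 0 < e / 6%:R by rewrite divr_gt0.
(* After rounding, [A m] depends on a floor only, so it is measurable without any measurability of
   [H] in [z]. The choice of [c0] lets a move of twice the mesh cost only [ln 3]. *)
pose grid m (z : R) : R := `|Num.floor (z * b%:R ^+ (m + c0))|%N%:R / b%:R ^+ (m + c0).
have close m x y : `|x - y| <= 2%:R / b%:R ^+ (m + c0) -> `|H x m - H y m| <= ln 3%:R.
  move=> h; apply: H_robust_norm; rewrite exprD in h.
  have h' : `|x - y| * b%:R ^+ m <= 2%:R / b%:R ^+ c0.
    by rewrite -ler_pdivlMr // -mulrA -invfM [b%:R ^+ c0 * _]mulrC.
  rewrite -mulrA; apply: le_trans (ler_wpM2l lipS_ge0 h') _.
  by rewrite mulrA ler_pdivrMr // mul1r ltW // hc0.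
have gridP m z : unit01 z -> `|z - grid m z| <= 1 / b%:R ^+ (m + c0).
  move=> /andP[z0 z1]; have h : 0 <= z * b%:R ^+ (m + c0) by rewrite mulr_ge0 // ltW.
  have /andP[h1 h2] := absz_floor_itv h.
  rewrite ler_pdivlMr // -[X in _ * X](gtr0_norm (bXpos (m + c0))) -normrM mulrBl /grid.
  rewrite divfK ?gt_eqF // ger0_norm; lra.
pose A m := [set z : R | deviates alpha (e / 3%:R) m (grid m z)].
have mA m : measurable (A m).
  apply: (measurable_pred_nat (g := fun z => `|Num.floor (z * b%:R ^+ (m + c0))|%N)
    _ (fun l => deviates alpha (e / 3%:R) m (l%:R / b%:R ^+ (m + c0)))) => l.
  by apply: measurable_absz_floor; exact: ltW.
have [m2 hm2] := linear_ge (ln 3%:R) e6.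
have [|m1 hm1] := pr_limsup0 mA mN N0 _ e0.
  move=> z u nz; have [m1 hm1] := exact_entropy (hN z u nz) e6.
  exists (maxn m1 m2) => m; rewrite geq_max => /andP[/hm1 h1 /hm2 h2].
  rewrite /A /= /deviates; apply/negP; rewrite -leNgt.
  have h3 := close m (grid m z) z _.
  have h4 : `|H (grid m z) m - H z m| <= ln 3%:R.
    apply: h3; rewrite distrC; apply: le_trans (gridP m z u) _.
    by rewrite ler_pM2r ?invr_gt0 // ler1n.
  apply: le_trans (ler_distD (H z m) _ _) _; apply: le_trans (lerD h4 h1) _.
  by apply: le_trans (lerD h2 (lexx _)) _; rewrite -mulrDl e663.
exists (maxn m1 m2) => m; rewrite geq_max => /andP[/hm1 h1 /hm2 h2].
exists (m + c0)%N => p hp x /andP[x0 x1].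
have bX := bXpos p.
have step (t : 'I_(b ^ p)) z : deviates alpha e m ((x + t%:R) / b%:R ^+ p) ->
   unit01 z -> `|Num.floor (z * b%:R ^+ p)|%N = t -> A m z.
  move=> dv u zt; rewrite /A /=.
  have hz : 0 <= z * b%:R ^+ p by case/andP: u => u0 _; rewrite mulr_ge0 // ltW.
  have := absz_floor_itv hz; rewrite zt => /andP[k1 k2].
  have k3 : `|(x + t%:R) / b%:R ^+ p - z| <= 1 / b%:R ^+ p.
    rewrite ler_pdivlMr // -[X in _ * X](gtr0_norm bX) -normrM mulrBl divfK ?gt_eqF //.
    rewrite ler_norml; apply/andP; split; lra.
  have k4 : 1 / b%:R ^+ p <= 1 / b%:R ^+ (m + c0) :> R.
    rewrite ler_pM2l // lef_pV2 ?posrE //; exact: ler_weXn2l.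
  have h5 : `|H ((x + t%:R) / b%:R ^+ p) m - H (grid m z) m| <= ln 3%:R.
    apply: close; apply: le_trans (ler_distD z _ _) _; rewrite two.
    exact: lerD (le_trans k3 k4) (gridP m z u).
  move: dv; rewrite /deviates => dv; rewrite ltNge; apply/negP => h6.
  have h7 := le_trans (ler_distD (H (grid m z) m) _ _) (lerD h5 h6).
  have /(le_trans h7) : ln 3%:R + e / 3%:R * (m%:R * ln b%:R) <= e * (m%:R * ln b%:R).
    apply: le_trans (lerD h2 (lexx _)) _; rewrite -mulrDl; apply: ler_wpM2r e631.
    exact: mulr_ge0 (ler0n _ _) (ltW lnb0).
  by rewrite leNgt dv.
rewrite -ler_pdivrMr //; apply: le_trans h1.
have mg l : measurable [set z : R | `|Num.floor (z * b%:R ^+ p)|%N = l].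
  by apply: measurable_absz_floor; exact: ltW.
rewrite (pr_partition mg (@absz_floor_lt p) (mA m)).
rewrite -sum1_card natr_sum mulr_suml big_mkcond /=; apply: ler_sum => t _.
rewrite inE; case: ifP => [dv|_]; last exact: pr_ge0.
rewrite mul1r -(pr_cell (ltn_ord t)).
apply: pr_le; [exact: mg|exact: (measurableI _ _ (mA m) (mg t))|].
move=> z u zt; split; [exact: step dv u zt|exact: zt].
Qed.

(** * Uniform non-concentration for [alpha > 0] *)

Lemma nbr_mass_le x m l (c : R) : (forall l', q x m l' <= c) -> nbr_mass x m l <= 5%:R * c.
Proof.
move=> qc; have c0 : 0 <= c by apply: le_trans (qc 0%N); exact: q_ge0.
apply: (@le_trans _ _ (\sum_(l' < width m | nbr l l') c)); first by apply: ler_sum.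
rewrite sumr_const -[leLHS]mulr_natl ler_wpM2r // ler_nat.
by have := card_nbr m l; rewrite cardsE.
Qed.

Lemma measurable_ball_S x y (r : R) : measurable [set w | `|Sw x w - y| <= r].
Proof.
apply: (measurable_S x (A := [set v | `|v - y| <= r])).
rewrite (_ : [set _ | _] = [set` `[y - r, y + r]]); first exact: measurable_itv.
by apply/seteqP; split => v /=; rewrite in_itv /= ler_distl.
Qed.

(** Around any value of [Sw x0] in the ball, the ball is covered by five neighbouring atoms, each of
    mass at most [e / 5]. *)
Lemma nonconcentration_at (x0 : R) : 0 < alpha -> exact_dimensional (m_x b gamma phi x0) alpha ->
  forall e : R, 0 < e -> exists2 r : R, 0 < r & forall y, pr [set w | `|Sw x0 w - y| <= r] <= e.
Proof.
move=> a0 ex e e0; have [m hm] := exact_atoms_small a0 ex (divr_gt0 e0 (ltr0n R 5)).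
exists ((2%:R * b%:R ^+ m)^-1); first by rewrite invr_gt0 mulr_gt0.
move=> y; set r := _^-1.
have [->|/pr_neq0 [w0 u0 /= h0]] := eqVneq (pr [set w | `|Sw x0 w - y| <= r]) 0; first exact: ltW.
apply: (@le_trans _ _ (nbr_mass x0 m (idx m (Sw x0 w0)))); last first.
  by apply: le_trans (nbr_mass_le _ hm) _; rewrite mulrCA mulfV ?mulr1.
rewrite /nbr_mass -sum_q_pred; apply: pr_le; first exact: measurable_ball_S.
  exact: (measurable_pred_nat (measurable_idx_S x0 m) (nbr (idx m (Sw x0 w0)))).
move=> w _ /= h; apply: idx_ball_out; [exact: S_bound|exact: S_bound|].
have -> : Sw x0 w0 - Sw x0 w = (Sw x0 w0 - y) - (Sw x0 w - y) by ring.
apply: le_lt_trans (ler_normB _ _) _.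
have -> : rad m = 4%:R * r by rewrite /rad /r; field; rewrite gt_eqF.
have : 0 < r by rewrite /r invr_gt0 mulr_gt0.
lra.
Qed.

(* One of the [b ^ Q] subpieces of [m_x] is close to the non-atomic [m_x0], so each zoom
   by [gamma ^ Q] contracts the maximal concentration towards [e] by [1 - b ^- Q]. *)
Lemma nonconcentration : 0 < alpha -> forall e : R, 0 < e ->
  exists2 r : R, 0 < r & forall x y, 0 <= x <= 1 -> pr [set w | `|Sw x w - y| <= r] <= e.
Proof.
move=> a0 e e0; have [x0 [ex0 ux0]] := exact_point.
have e2 : 0 < e / 2%:R by rewrite divr_gt0.
have [r r0 hr] := nonconcentration_at a0 ex0 e2.
have [Q hQ] := natpow_gt (lipS * 2%:R / r); have {}hQ := hQ Q (leqnn Q).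
have bQ := bXpos Q; set beta := b%:R ^+ Q in hQ bQ.
have b1 : 0 <= 1 - beta^-1 < 1.
  have : 0 < beta^-1 by rewrite invr_gt0.
  have : beta^-1 <= 1 by rewrite invf_le1 // /beta exprn_ege1.
  by move=> h1 h2; apply/andP; split; lra.
(* The bound solves [a_(n+1) = (1 - 1/beta) * a_n + (1/beta) * (e/2)]: the subpiece near [x0]
   contributes at most [e / 2], the other [beta - 1] fall under the induction hypothesis. *)
have key n : forall x y, 0 <= x <= 1 ->
    pr [set w | `|Sw x w - y| <= r / 2%:R * gamma ^+ (Q * n)] <= (1 - beta^-1) ^+ n + e / 2%:R.
  elim: n => [|n IH] x y x01.
    rewrite expr0; apply: (@le_trans _ _ 1); last by rewrite lerDl ltW.
    exact: pr_le1 (measurable_ball_S _ _ _).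
  set rn := r / 2%:R * gamma ^+ (Q * n).
  have rnr : rn <= r / 2%:R.
    by rewrite /rn ger_pMr ?divr_gt0 // exprn_ile1 // ltW.
  have mv : measurable [set v : R | `|v - y| <= r / 2%:R * gamma ^+ (Q * n.+1)].
    rewrite (_ : [set _ | _] = [set` `[y - r / 2%:R * gamma ^+ (Q * n.+1), y + r / 2%:R * gamma ^+ (Q * n.+1)]]); first exact: measurable_itv.
    by apply/seteqP; split => v /=; rewrite in_itv /= ler_distl.
  rewrite (pr_selfsimilar Q x mv) -/beta.
  have gQ : 0 < gamma ^+ Q by rewrite exprn_gt0.
  pose y' t := (y - offset Q x t) / gamma ^+ Q.
  have pcE t : pr [set w | `|piece Q x t w - y| <= r / 2%:R * gamma ^+ (Q * n.+1)] =
      pr [set w | `|Sw ((x + t%:R) / beta) w - y' t| <= rn].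
    apply: pr_ext => w _ /=; rewrite /piece -/beta.
    have -> : offset Q x t + gamma ^+ Q * Sw ((x + t%:R) / beta) w - y =
       gamma ^+ Q * (Sw ((x + t%:R) / beta) w - y' t).
      by rewrite /y'; field; rewrite gt_eqF.
    rewrite normrM (gtr0_norm gQ) mulnS exprD mulrCA ler_pM2l // .
  (* [t0] is the cell of [x0], so its base point is within [1 / beta] of [x0]; [Q] is such that S
     then moves by at most [r / 2]. *)
  have t0P : (`|Num.floor (x0 * b%:R ^+ Q)| < b ^ Q)%N by exact: absz_floor_lt.
  pose t0 := Ordinal t0P.
  have ht0 : pr [set w | `|Sw ((x + t0%:R) / beta) w - y' t0| <= rn] <= e / 2%:R.
    apply: le_trans (hr (y' t0)); apply: pr_le; [exact: measurable_ball_S|exact: measurable_ball_S|].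
    move=> w _ /= h.
    have -> : Sw x0 w - y' t0 = (Sw x0 w - Sw ((x + t0%:R) / beta) w) + (Sw ((x + t0%:R) / beta) w - y' t0) by ring.
    apply: le_trans (ler_normD _ _) _.
    have hl := S_fun_lipschitz b2 gamma01 phi_bound phi_lip x0 ((x + t0%:R) / beta) (digits b w).
    have hx : `|x0 - (x + t0%:R) / beta| <= 1 / beta.
      have hz : 0 <= x0 * beta by case/andP: ux0 => u0 _; rewrite mulr_ge0 // ltW.
      have := absz_floor_itv hz; rewrite -[`|_|%N]/(nat_of_ord t0) => /andP[k1 k2].
      rewrite ler_pdivlMr // -[X in _ * X](gtr0_norm bQ) -normrM mulrBl divfK ?gt_eqF //.
      case/andP: x01 => x0' x1'; rewrite ler_norml; apply/andP; split; lra.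
    have := ler_wpM2l lipS_ge0 hx.
    rewrite ltr_pdivrMr // in hQ.
    have : lipS * (1 / beta) <= r / 2%:R.
      by rewrite mulrA mulr1 ler_pdivrMr //; lra.
    rewrite -/lipS in hl; rewrite /Sdig in h *; lra.
  rewrite (bigD1 t0) //= pcE ler_pdivrMl //.
  have hs : \sum_(t < b ^ Q | t != t0) pr [set w | `|piece Q x t w - y| <= r / 2%:R * gamma ^+ (Q * n.+1)] <=
     (beta - 1) * ((1 - beta^-1) ^+ n + e / 2%:R).
    apply: (@le_trans _ _ (\sum_(t < b ^ Q | t != t0) ((1 - beta^-1) ^+ n + e / 2%:R))).
      by apply: ler_sum => t _; rewrite pcE; exact: IH (grid_point01 t x01).
    rewrite sumr_const -[leLHS]mulr_natl cardC1 card_ord /beta -natrX.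
    by rewrite -subn1 natrB // expn_gt0 (leq_trans _ b2).
  apply: le_trans (lerD ht0 hs) _.
  rewrite exprS (_ : beta * ((1 - beta^-1) * (1 - beta^-1) ^+ n + e / 2%:R) =
    (beta - 1) * (1 - beta^-1) ^+ n + beta * (e / 2%:R)); last by field; rewrite gt_eqF.
  lra.
have [n hn] := expn_lt b1 e2.
exists (r / 2%:R * gamma ^+ (Q * n)); first by rewrite mulr_gt0 ?divr_gt0 // exprn_gt0.
move=> x y xx; apply: le_trans (key n x y xx) _; have := hn n (leqnn n); lra.
Qed.

Let Dpos : 0 < D%:R :> R. Proof. by rewrite ltr0n D_gt0. Qed.

(** * Lower bound for the entropy of components *)

Lemma gamma_scale (s : R) : 0 < s <= 1 -> exists p, gamma * s <= gamma ^+ p < s.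
Proof.
move=> /andP[s0 s1].
have ex : exists p, gamma ^+ p < s.
  by have [|n hn] := @expn_lt gamma s _ s0; [rewrite ltW|exists n; exact: hn].
case: (ex_minnP ex) => -[|p] hp pmin; first by rewrite expr0 ltNge s1 in hp.
exists p.+1; rewrite hp andbT exprS ler_pM2l // leNgt; apply/negP => /pmin.
by rewrite ltnn.
Qed.

Lemma piece_diff p x t w w' :
  piece p x t w - piece p x t w' =
  gamma ^+ p * (Sw ((x + t%:R) / b%:R ^+ p) w - Sw ((x + t%:R) / b%:R ^+ p) w').
Proof. by rewrite /piece; ring. Qed.

Lemma S_diff y w w' : `|Sw y w - Sw y w'| <= 2%:R * D%:R.
Proof.
apply: le_trans (ler_normB _ _) _.
by have := S_bound y w; have := S_bound y w'; lra.
Qed.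

Lemma measurable_idx_piece p x t i l : measurable [set w | idx i (piece p x t w) = l].
Proof. exact: (measurable_affine_S _ _ _ (measurable_idx i l)). Qed.

(** Mass of the atom times the entropy of its component. In this form null atoms give 0, and the sum
    over [l] is [H x (i + m) - H x i]. *)
Definition cond_ent (x : R) (i m l : nat) : R :=
  \sum_(l' < b ^ m) xent (q x (i + m) (l * b ^ m + l')) - xent (q x i l).

Lemma cond_ent_ge0 x i m l : 0 <= cond_ent x i m l.
Proof.
rewrite subr_ge0 /q -(@pr_refine (Sw x) i m l (S_bound x) (measurable_idx_S x)).
by apply: (@xent_sum_le R _ (fun l' : 'I_(b ^ m) => q x (i + m) (l * b ^ m + l')%N)) => l'; exact: q_ge0.
Qed.

Lemma sum_cond_ent x i m : \sum_(l < width i) cond_ent x i m l = H x (i + m) - H x i.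
Proof.
by rewrite /cond_ent sumrB /H width_add (sum_ord_mul (width i) (b ^ m) (fun s => xent (q x (i + m) s))).
Qed.

Definition inside (p : nat) (x : R) (i t l : nat) : bool :=
  `[< forall w, unit01 w -> idx i (piece p x t w) = l >].

(** Undoing the scaling by [gamma ^ p], an atom of level [i + m] becomes an interval of
    [1 / (gamma ^ p * b ^ i)] lengths of level-[m] atoms. The second hypothesis says that this
    number is at most [c - 1], so the interval meets indices in a window of length [c]. *)
Lemma piece_entropy (p i m c : nat) x t l : inside p x i t l ->
  1 <= c%:R * (gamma ^+ p * b%:R ^+ i) - gamma ^+ p * b%:R ^+ i ->
  H ((x + t%:R) / b%:R ^+ p) m <=
  \sum_(l' < b ^ m) xent (pr [set w | idx (i + m) (piece p x t w) = (l * b ^ m + l')%N]) + ln c%:R.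
Proof.
move=> /asboolP ins hc; set y := (x + _) / _.
pose g w := (idx (i + m) (piece p x t w) %% b ^ m)%N.
have gP w : unit01 w -> idx (i + m) (piece p x t w) = (l * b ^ m + g w)%N.
  move=> u; rewrite /g {1}(divn_eq (idx (i + m) (piece p x t w)) (b ^ m)).
  by rewrite idx_refine ?piece_bound // ins.
have gE (l' : 'I_(b ^ m)) : pr [set w | idx (i + m) (piece p x t w) = (l * b ^ m + l')%N] =
    pr [set w | g w = l'].
  apply: pr_ext => w u /=; rewrite gP //; split; last by move->.
  by move=> h; apply/eqP; rewrite -(eqn_add2l (l * b ^ m)) h.
under eq_bigr => l' _ do rewrite gE.
apply: entropy_spread.
- exact: measurable_idx_S.
- move=> j; exact: (measurable_pred_nat (measurable_idx_piece p x t (i + m)) (fun n => n %% b ^ m = j)%N).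
- by move=> w _; exact: idx_lt (S_bound _ w).
- by move=> w _; rewrite /g ltn_mod expn_gt0 (leq_trans _ b2).
move=> w w' u u' e.
have e' : idx (i + m) (piece p x t w) = idx (i + m) (piece p x t w') by rewrite !gP // e.
have k0 : 0 < gamma ^+ p * b%:R ^+ i by rewrite mulr_gt0 // exprn_gt0.
apply: (@idx_close _ _ _ ((gamma ^+ p * b%:R ^+ i)^-1)); [exact: S_bound|exact: S_bound| |].
  have := idx_itv (i + m) (piece_bound p x t w); have := idx_itv (i + m) (piece_bound p x t w').
  rewrite e' => /andP[h1 h2] /andP[h3 h4].
  have : (piece p x t w - piece p x t w') * b%:R ^+ (i + m) <= 1.
    by move: h1 h2 h3 h4; rewrite mulrBl !mulrDl; lra.
  rewrite piece_diff -/y exprD => h5.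
  rewrite -[leRHS]mul1r ler_pdivlMr //; apply: le_trans h5.
  by rewrite le_eqVlt; apply/orP; left; apply/eqP; ring.
rewrite -(ler_pM2r k0) mulrDl mulVf ?gt_eqF // mul1r; lra.
Qed.

(** [entropy_cond_le] for the joint law of the piece [t] and the subatom [l']. A counted piece puts
    all its mass b^-p into the atom and has entropy at least [a]; the others contribute
    nonnegatively. *)
Lemma cond_ent_lower (p i m c : nat) x l (a : R) (good : pred nat) :
  1 <= c%:R * (gamma ^+ p * b%:R ^+ i) - gamma ^+ p * b%:R ^+ i ->
  (forall t : 'I_(b ^ p), good t -> a <= H ((x + t%:R) / b%:R ^+ p) m - ln c%:R) ->
  (b%:R ^+ p)^-1 * #|[set t : 'I_(b ^ p) | good t && inside p x i t l]%SET|%:R * a <= cond_ent x i m l.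
Proof.
move=> hc ha; have bV : 0 < (b%:R ^+ p)^-1 :> R by rewrite invr_gt0.
pose P (t : 'I_(b ^ p)) (l' : 'I_(b ^ m)) := pr [set w | idx (i + m) (piece p x t w) = (l * b ^ m + l')%N].
pose r t l' := (b%:R ^+ p)^-1 * P t l'.
have P0 t l' : 0 <= P t l' by exact: pr_ge0.
have r0 t l' : 0 <= r t l' by rewrite mulr_ge0 // ltW.
have rowE t : \sum_l' P t l' = pr [set w | idx i (piece p x t w) = l].
  apply: (@pr_refine (piece p x t)); first exact: piece_bound.
  by move=> k j; exact: measurable_idx_piece.
have colE (l' : 'I_(b ^ m)) : \sum_t r t l' = q x (i + m) (l * b ^ m + l').
  by rewrite /q (pr_selfsimilar p x (measurable_idx (i + m) _)) mulr_sumr.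
have totE : \sum_t \sum_l' r t l' = q x i l.
  rewrite /q (pr_selfsimilar p x (measurable_idx i l)) mulr_sumr; apply: eq_bigr => t _.
  by rewrite -mulr_sumr rowE.
have := entropy_cond_le r0; rewrite totE.
under [X in _ <= X - _]eq_bigr => l' _ do rewrite colE.
move=> h; apply: le_trans h.
rewrite -sum1_card natr_sum big_mkcond /= -mulrA mulr_suml mulr_sumr; apply: ler_sum => t _.
rewrite xent_scale_cond // ler_pM2l // rowE inE; case: ifP => [/andP[gt it]|_]; last first.
  by rewrite mul0r subr_ge0 -rowE xent_sum_le.
rewrite mul1r (_ : pr [set w | idx i (piece p x t w) = l] = 1); last first.
  by apply: pr_full => w u; move/asboolP: it => it; exact: it.
by rewrite xent1 subr0; have := piece_entropy m it hc; have := ha t gt; rewrite -/(P t _); lra.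
Qed.

Lemma inside_le_q (p i : nat) x l (good : pred nat) :
  (b%:R ^+ p)^-1 * #|[set t : 'I_(b ^ p) | good t && inside p x i t l]%SET|%:R <= q x i l.
Proof.
have bV : 0 < (b%:R ^+ p)^-1 :> R by rewrite invr_gt0.
rewrite /q (pr_selfsimilar p x (measurable_idx i l)) ler_pM2l //.
rewrite -sum1_card natr_sum big_mkcond /=; apply: ler_sum => t _.
rewrite inE; case: ifP => [/andP[_ /asboolP it]|_]; last exact: pr_ge0.
by rewrite pr_full.
Qed.

Definition frac (i : nat) (y : R) : R := (y + D%:R) * b%:R ^+ i - (idx i y)%:R.

Definition near_grid (i : nat) (d : R) : set R := [set y | frac i y <= d \/ 1 - d <= frac i y].

Lemma measurable_near_grid i d : measurable (near_grid i d).
Proof.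
have mf : measurable_fun [set: R] (frac i).
  apply: measurable_funB.
    apply: measurable_funM; last exact: measurable_cst.
    by apply: measurable_funD.
  move=> _ Y mY; rewrite setTI.
  exact: (measurable_pred_nat (measurable_idx i) (fun l => Y l%:R)).
rewrite (_ : near_grid i d = frac i @^-1` [set` `]-oo, d]] `|` frac i @^-1` [set` `[1 - d, +oo[]).
  by apply: measurableU; rewrite -[_ @^-1` _]setTI; apply: mf => //; exact: measurable_itv.
by apply/seteqP; split => y /=; rewrite !in_itv /= andbT.
Qed.

Lemma near_gridP i d y : `|y| < D%:R -> near_grid i d y ->
  exists n : nat, `|(y + D%:R) * b%:R ^+ i - n%:R| <= d.
Proof.
move=> yD; have := idx_itv i yD; rewrite /near_grid /frac /= => /andP[h1 h2] [h|h].
  by exists (idx i y); rewrite ger0_norm //; lra.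
by exists (idx i y).+1; rewrite -natr1 ler_norml; apply/andP; split; lra.
Qed.

(** The piece has diameter at most [d] atom lengths, so one point farther than [d] from the boundary
    would trap the whole piece in its atom. *)
Lemma inside_or_near (p i : nat) x t (d : R) : gamma ^+ p * (2%:R * D%:R) * b%:R ^+ i <= d ->
  (forall l : 'I_(width i), ~~ inside p x i t l) ->
  forall w, unit01 w -> near_grid i d (piece p x t w).
Proof.
move=> hd ni w u; rewrite /near_grid /=.
have [|h1] := leP (frac i (piece p x t w)) d; [by left|right].
rewrite leNgt; apply/negP => h2.
have /negP := ni (Ordinal (idx_lt i (piece_bound p x t w))); apply; apply/asboolP => w' u' /=.
apply: idx_def; move: h1 h2; rewrite /frac => h1 h2.
have : `|(piece p x t w' - piece p x t w) * b%:R ^+ i| <= d.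
  apply: le_trans hd; rewrite piece_diff normrM (gtr0_norm (bXpos i)) ler_pM2r //.
  rewrite normrM gtr0_norm ?exprn_gt0 // ler_pM2l ?exprn_gt0 //; exact: S_diff.
rewrite ler_norml mulrBl !mulrDl => /andP[h3 h4]; rewrite !mulrDl in h1 h2; apply/andP; split; lra.
Qed.

(** Pieces with [gamma ^ p] just below [1 / (8 D b^i)] have diameter at most a quarter atom. Two
    near points of one piece then have boundary points less than 1 atom length apart, hence equal.
    Zooming in, the near part lies in a ball of radius [16 D d / gamma <= r] for [m_y], where
    non-concentration applies. *)
Lemma near_grid_small (e r d : R) i : 0 < r -> 0 <= d <= 1 / 4%:R ->
  16%:R * D%:R * d <= gamma * r ->
  (forall x y, 0 <= x <= 1 -> pr [set w | `|Sw x w - y| <= r] <= e) -> 0 <= e ->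
  forall x, 0 <= x <= 1 -> pr [set w | near_grid i d (Sw x w)] <= e.
Proof.
move=> r0 /andP[d0 d4] hr hnc e0 x x01.
have s01 : 0 < ((8%:R * D%:R * b%:R ^+ i)^-1 : R) <= 1.
  rewrite invr_gt0 !mulr_gt0 //= invf_le1 ?mulr_gt0 //.
  rewrite -natrX -!natrM ler1n muln_gt0 muln_gt0 D_gt0 expn_gt0 (leq_trans _ b2) //.
have [p /andP[p1 p2]] := gamma_scale s01.
have gp : 0 < gamma ^+ p by rewrite exprn_gt0.
have k0 : 0 < 8%:R * D%:R * b%:R ^+ i :> R by rewrite !mulr_gt0.
have q1 : gamma <= gamma ^+ p * (8%:R * D%:R * b%:R ^+ i) by rewrite -ler_pdivrMr.
have q2 : gamma ^+ p * (8%:R * D%:R * b%:R ^+ i) < 1 by rewrite -ltr_pdivlMr // div1r.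
rewrite (pr_selfsimilar p x (measurable_near_grid i d)) ler_pdivrMl //.
rewrite mulrC -natrX mulr_natr -[X in _ *+ X](card_ord (b ^ p)) -sumr_const.
apply: ler_sum => t _.
have [->//|/pr_neq0 [w0 u0 /= n0]] := eqVneq (pr [set w | near_grid i d (piece p x t w)]) 0.
have tx := grid_point01 t x01.
apply: le_trans (hnc _ (Sw ((x + t%:R) / b%:R ^+ p) w0) tx).
apply: pr_le; [exact: (measurable_affine_S _ _ _ (measurable_near_grid i d))|exact: measurable_ball_S|].
move=> w u nw; have [n hn] := near_gridP (piece_bound p x t w) nw.
have [n' hn'] := near_gridP (piece_bound p x t w0) n0.
set y := (x + _) / _ in tx *.
have df : `|(piece p x t w - piece p x t w0) * b%:R ^+ i| <= 1 / 4%:R.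
  rewrite piece_diff -/y normrM (gtr0_norm (bXpos i)) normrM (gtr0_norm gp).
  have := ler_wpM2l (ltW (mulr_gt0 gp (bXpos i))) (S_diff y w w0).
  move: q2; lra.
have nn : n = n'.
  apply: (@natr_close R); rewrite mulrBl in df; rewrite ltr_norml; move: hn hn' df.
  by rewrite !ler_norml !mulrDl => /andP[? ?] /andP[? ?] /andP[? ?]; apply/andP; split; lra.
subst n'.
have : `|(piece p x t w - piece p x t w0) * b%:R ^+ i| <= 2%:R * d.
  rewrite mulrBl; move: hn hn'; rewrite !ler_norml !mulrDl => /andP[? ?] /andP[? ?].
  by apply/andP; split; lra.
rewrite piece_diff -/y normrM (gtr0_norm (bXpos i)) normrM (gtr0_norm gp) => h.
rewrite /= -(ler_pM2l g0); apply: le_trans hr.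
have := normr_ge0 (Sw y w - Sw y w0); set z := `|_| in h * => z0.
have := ler_wpM2r z0 q1.
have : 0 <= D%:R * (2%:R * d - gamma ^+ p * z * b%:R ^+ i).
  by apply: mulr_ge0; [exact: ltW Dpos|rewrite subr_ge0].
lra.
Qed.

Lemma card_sum_pred (T : finType) (P : pred T) : #|[set t | P t]%SET|%:R = \sum_t (P t)%:R :> R.
Proof.
by rewrite -sum1_card natr_sum big_mkcond /=; apply: eq_bigr => t _; rewrite inE; case: (P t).
Qed.

(* Level-[i] atoms are refined by pieces of size [~ b^-(i+l)]; all but few of these avoid
   the boundaries of the atoms, and each contributes the entropy of some [m_y]. *)
Lemma cond_ent_mostly_large (e : R) : 0 < e -> exists M, forall m, (M <= m)%N ->
  exists i0, forall i, (i0 <= i)%N -> forall x, 0 <= x <= 1 ->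
  exists rho : nat -> R, [/\ forall l, rho l <= q x i l,
    1 - e <= \sum_(l < width i) rho l &
    forall l, rho l * (Num.max 0 (alpha - e) * (m%:R * ln b%:R)) <= cond_ent x i m l].
Proof.
(* If [alpha <= e] the required entropy is 0, and [rho = q] works. *)
move=> e0; have [ae|ea] := leP (alpha - e) 0.
  exists 0%N => m _; exists 0%N => i _ x _; exists (q x i); split => // [|l].
    by rewrite sum_q; lra.
  by rewrite mul0r mulr0 cond_ent_ge0.
have a0 : 0 < alpha by lra.
have e2 : 0 < e / 2%:R by rewrite divr_gt0.
have [r r0 hr] := nonconcentration a0 e2.
(* Chosen so that [d = b^-ell] satisfies both size conditions of [near_grid_small]. *)
have [ell hell] := natpow_gt (16%:R * D%:R / (gamma * r) + 4%:R).
have {}hell := hell ell (leqnn ell).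
set bl := b%:R ^+ ell in hell.
have bl0 : 0 < bl by rewrite exprn_gt0.
have gr : 0 < gamma * r by rewrite mulr_gt0.
have Dgr : 0 <= 16%:R * D%:R / (gamma * r) by rewrite divr_ge0 ?(ltW gr) // mulr_ge0.
(* An upper bound for [1 / (gamma ^ p * b ^ i)] that does not depend on [i], so [c] is fixed before
   [m] and [ln c] is absorbed by [e / 2 * (m * ln b)]. *)
pose X := 2%:R * D%:R * bl / gamma.
have X0 : 0 <= X by rewrite divr_ge0 ?(ltW g0) // mulr_ge0 ?(ltW bl0) // mulr_ge0.
pose c := (Num.bound X).+1.
have cX : X <= c%:R - 1.
  by rewrite /c -natr1 addrK ltW //; have := archi_boundP X0.
have [m0 hm0] := grid_entropy e2.
have [m1 hm1] := linear_ge (ln c%:R) e2.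
exists (maxn m0 m1) => m; rewrite geq_max => /andP[/hm0 [p0 hp0] /hm1 hc].
(* From this scale on, the piece level [p] found below is at least [p0], so [grid_entropy] applies
   to the base points of the pieces. *)
have [i0 hi0] := natpow_gt (gamma ^+ p0)^-1.
exists i0 => i /hi0 hi x x01.
have bi := bXpos i.
have k0 : 0 < 2%:R * D%:R * bl * b%:R ^+ i by rewrite !mulr_gt0.
have D1 : 1 <= D%:R :> R by rewrite ler1n D_gt0.
have bl1 : 1 <= bl by rewrite exprn_ege1.
have kb : b%:R ^+ i <= 2%:R * D%:R * bl * b%:R ^+ i.
  rewrite ler_peMl ?(ltW bi) // -[1]mulr1 ler_pM //; lra.
have s01 : 0 < ((2%:R * D%:R * bl * b%:R ^+ i)^-1 : R) <= 1.
  rewrite invr_gt0 k0 /= invf_le1 //; apply: le_trans kb.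
  by rewrite exprn_ege1.
have [p /andP[p1 p2]] := gamma_scale s01.
have gp : 0 < gamma ^+ p by rewrite exprn_gt0.
have q1 : gamma <= gamma ^+ p * (2%:R * D%:R * bl * b%:R ^+ i) by rewrite -ler_pdivrMr.
have q2 : gamma ^+ p * (2%:R * D%:R * bl * b%:R ^+ i) < 1 by rewrite -ltr_pdivlMr // div1r.
have pp0 : (p0 <= p)%N.
  rewrite leqNgt; apply/negP => pl.
  have : gamma ^+ p0 <= gamma ^+ p by rewrite ler_wiXn2l ?(ltW g0) ?(ltW g1) // ltnW.
  have : gamma ^+ p * b%:R ^+ i < 1 by apply: le_lt_trans q2; rewrite ler_pM2l.
  have gp0 : 0 < gamma ^+ p0 by rewrite exprn_gt0.
  have : 1 < gamma ^+ p0 * b%:R ^+ i by rewrite mulrC -ltr_pdivrMr // div1r.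
  move=> h1 h2 h3; have := le_lt_trans (ler_wpM2r (ltW bi) h3) h2.
  by rewrite ltNge (ltW h1).
have dev := hp0 p pp0 x x01.
pose good (t : nat) := ~~ deviates alpha (e / 2%:R) m ((x + t%:R) / b%:R ^+ p).
have blk : 1 <= c%:R * (gamma ^+ p * b%:R ^+ i) - gamma ^+ p * b%:R ^+ i.
  rewrite -[X in _ - X]mul1r -mulrBl.
  have kp : 0 < gamma ^+ p * b%:R ^+ i by rewrite mulr_gt0.
  apply: le_trans (ler_wpM2r (ltW kp) cX); rewrite /X mulrAC ler_pdivlMr // mul1r.
  by apply: le_trans q1 _; rewrite le_eqVlt; apply/orP; left; apply/eqP; ring.
have ha (t : 'I_(b ^ p)) : good t ->
    (alpha - e) * (m%:R * ln b%:R) <= H ((x + t%:R) / b%:R ^+ p) m - ln c%:R.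
  rewrite /good /deviates -leNgt ler_norml => /andP[h1 _]; lra.
(* The weight of [l] is the mass of the good pieces inside that atom. The loss is at most [e / 2]
   for deviating base points and [e / 2] for pieces crossing a boundary. *)
exists (fun l => (b%:R ^+ p)^-1 * #|[set t : 'I_(b ^ p) | good t && inside p x i t l]%SET|%:R); split.
- by move=> l; exact: inside_le_q.
- pose cross (t : 'I_(b ^ p)) := [forall l : 'I_(width i), ~~ inside p x i t l].
  have bp := bXpos p.
  have d01 : 0 <= bl^-1 <= 1 / 4%:R.
    by rewrite invr_ge0 (ltW bl0) /= div1r lef_pV2 ?posrE //; lra.
  have d16 : 16%:R * D%:R * bl^-1 <= gamma * r.
    have h : 16%:R * D%:R / (gamma * r) <= bl by lra.
    by rewrite ler_pdivrMr // [leRHS]mulrC -ler_pdivrMr.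
  have crossle : (b%:R ^+ p)^-1 * \sum_t (cross t)%:R <= e / 2%:R.
    apply: le_trans (near_grid_small i r0 d01 d16 hr (ltW e2) x01).
    rewrite (pr_selfsimilar p x (measurable_near_grid i bl^-1)) ler_pM2l ?invr_gt0 //.
    apply: ler_sum => t _; case: (boolP (cross t)) => [/forallP ct|_]; last exact: pr_ge0.
    rewrite pr_full // => w u; apply: (inside_or_near _ ct u).
    rewrite -[leRHS]div1r ler_pdivlMr //; apply: le_trans (ltW q2).
    by rewrite le_eqVlt; apply/orP; left; apply/eqP; ring.
  have devle : (b%:R ^+ p)^-1 * \sum_(t < b ^ p) (~~ good t)%:R <= e / 2%:R.
    rewrite ler_pdivrMl // mulrC; apply: le_trans dev; rewrite card_sum_pred.
    by apply: ler_sum => t _; rewrite /good negbK.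
  rewrite -mulr_sumr.
  under eq_bigr => l _ do rewrite card_sum_pred.
  rewrite exchange_big /=.
  have : \sum_(t < b ^ p) (1 - (~~ good t)%:R - (cross t)%:R) <=
      \sum_(t < b ^ p) \sum_(l < width i) (good t && inside p x i t l)%:R :> R.
    apply: ler_sum => t _; case: (boolP (good t)) => gt /=; last first.
      by rewrite subrr sub0r; apply: (@le_trans _ _ 0); [rewrite oppr_le0|apply: sumr_ge0].
    case: (boolP (cross t)) => [_|]; first by rewrite subr0 subrr sumr_ge0.
    rewrite negb_forall => /existsP[l]; rewrite negbK => il.
    by rewrite !subr0 (bigD1 l) //= il lerDl sumr_ge0.
  rewrite !sumrB sumr_const card_ord natrX => h.
  have bV : 0 < (b%:R ^+ p)^-1 :> R by rewrite invr_gt0.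
  have := ler_wpM2l (ltW bV) h.
  rewrite !mulrBr mulVf ?gt_eqF //; lra.
- move=> l; apply: cond_ent_lower; [exact: blk|exact: ha].
Qed.

(** * Telescoping over scales, and porosity *)

Lemma sum_H_shift x k m :
  \sum_(1 <= i < k.+1) (H x (i + m) - H x i) <= m%:R * (H x k + m%:R * ln b%:R).
Proof.
elim: m => [|m IH].
  by rewrite mul0r big1_seq // => i _; rewrite addn0 subrr.
(* Each unit of the shift adds one sum that telescopes to [H x (k.+1 + m) - H x (1 + m)], at most
   [H x k + m.+1 * ln b] by [H_add]. *)
have -> : \sum_(1 <= i < k.+1) (H x (i + m.+1) - H x i) =
   \sum_(1 <= i < k.+1) (H x (i.+1 + m) - H x (i + m)) + \sum_(1 <= i < k.+1) (H x (i + m) - H x i).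
  by rewrite -big_split /=; apply: eq_bigr => i _; rewrite addrA subrK addSnnS.
rewrite telescope_sumr //.
have h1 := H_add x k m.+1; rewrite -addSnnS in h1.
have h2 := H_ge0 x (1 + m)%N.
have h3 : 0 <= m%:R * ln (b%:R : R) by rewrite mulr_ge0 // (ltW lnb0).
rewrite -natr1 in h1 *; have := lnb0; lra.
Qed.

Definition cond_ent_logb (x : R) (i m l : nat) : R :=
  - \sum_(l' < b ^ m) xlogb b (q x (i + m) (l * b ^ m + l') / q x i l).

Lemma q_refine_le x i m l (l' : 'I_(b ^ m)) : q x (i + m) (l * b ^ m + l') <= q x i l.
Proof.
apply: pr_le; [exact: measurable_idx_S|exact: measurable_idx_S|].
by move=> w _ /=; exact: refine_eq (S_bound x w) (ltn_ord l').
Qed.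

(** Links the normalised base-[b] entropy in the definition of porosity to [cond_ent]. Division by a
    null mass is harmless, since the subatoms are then null too. *)
Lemma cond_ent_logbE x i m l : q x i l * cond_ent_logb x i m l * ln b%:R = cond_ent x i m l.
Proof.
have lb : ln b%:R != 0 :> R by rewrite gt_eqF // lnb0.
have [qz|qn] := eqVneq (q x i l) 0.
  have z (l' : 'I_(b ^ m)) : q x (i + m) (l * b ^ m + l') = 0.
    by apply/eqP; rewrite eq_le q_ge0 andbT -qz q_refine_le.
  rewrite /cond_ent qz !mul0r xent0 subr0 big1 // => l' _.
  by rewrite z xent0.
have qp : 0 < q x i l by rewrite lt_neqAle eq_sym qn q_ge0.
rewrite /cond_ent /cond_ent_logb {2}/xent opprK.
rewrite -[X in X * ln (q x i l)](@pr_refine (Sw x) i m l (S_bound x) (measurable_idx_S x)).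
rewrite mulrN -mulNr mulr_sumr !mulr_suml -big_split /=; apply: eq_bigr => l' _.
rewrite -/(q x (i + m) (l * b ^ m + l')); set z := q x (i + m) _.
rewrite /xlogb /xent; have := q_ge0 x (i + m) (l * b ^ m + l'); rewrite -/z le0r => /orP[/eqP->|zp].
  by rewrite mul0r eqxx mulr0 !mul0r oppr0 addr0.
rewrite mulf_eq0 (gt_eqF zp) invr_eq0 (negbTE qn) /= ln_div ?posrE //.
by field; rewrite lb qn.
Qed.

Lemma Lidx_idx i y : `|y| < D%:R -> Lidx b i y = (idx i y)%:Z - (D * b ^ i)%N%:Z.
Proof.
move=> yD; have := idx_itv i yD; rewrite mulrDl => /andP[h1 h2]; apply: floor_def.
by rewrite !intrD mulrNz -!pmulrn natrM natrX; apply/andP; split; lra.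
Qed.

Lemma Lint_idx i l y : `|y| < D%:R ->
  Lint b i (l%:Z - (D * b ^ i)%N%:Z) y <-> idx i y = l.
Proof.
move=> yD; have bi := bXpos i.
rewrite /Lint /= ler_pdivrMr // ltr_pdivlMr // !intrD mulrNz -!pmulrn natrM natrX; split.
  by move=> /andP[h1 h2]; apply: idx_def; rewrite mulrDl; apply/andP; split; lra.
move=> <-; have := idx_itv i yD; rewrite mulrDl => /andP[h1 h2]; apply/andP; split; lra.
Qed.

Lemma Hcond_idx x i m y : `|y| < D%:R ->
  Hcond b (m_x b gamma phi x) y i m = cond_ent_logb x i m (idx i y).
Proof.
move=> yD; rewrite /Hcond /cond_ent_logb; congr (- _); apply: eq_bigr => l' _; congr (xlogb b _).
rewrite /mu_cond (Lidx_idx i yD) !m_xE; congr (_ / _); last first.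
  by apply: pr_ext => w _ /=; apply: Lint_idx; exact: S_bound.
rewrite (_ : ((idx i y)%:Z - (D * b ^ i)%N%:Z) * (b ^ m)%:Z + (nat_of_ord l')%:Z =
   (idx i y * b ^ m + l')%N%:Z - (D * b ^ (i + m))%N%:Z); last first.
  by rewrite mulrBl -!PoszM addrAC -PoszD -mulnA -expnD.
apply: pr_ext => w _ /=; have sb := S_bound x w; split.
  by move=> [/(Lint_idx _ _ sb)].
move=> e; split; first by apply/(Lint_idx _ _ sb).
by apply/(Lint_idx _ _ sb); exact: refine_eq sb (ltn_ord l') e.
Qed.

(** For negative [alpha], [exact_entropy] would make the entropy at most [alpha / 2 * (m * ln b)],
    which is negative. *)
Lemma alpha_ge0 : 0 <= alpha.
Proof.
have [x0 [ex0 _]] := exact_point.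
rewrite leNgt; apply/negP => an.
have e0 : 0 < - alpha / 2%:R by lra.
have [m0 hm] := exact_entropy ex0 e0.
have := hm m0.+1 (leqnSn _); have := H_ge0 x0 m0.+1.
have : 0 < m0.+1%:R * ln b%:R :> R by rewrite mulr_gt0 // lnb0.
set t := _ * ln _ => t0 h1; rewrite ler_norml => /andP[_ h2].
have := mulr_gt0 e0 t0; lra.
Qed.

(** Markov inequality for the surplus over the lower bound: at each scale the total entropy
    increment minus the guaranteed [(1 - e) * A * t] pays [eps * t] per unit of bad mass. Summed
    over scales, [m] on the right comes from [sum_H_shift] and [i0 * alpha] from the scales without
    a lower bound. *)
Lemma porous_deficit (x eps : R) m k (e : R) i0 : 0 < eps -> 0 < e <= 1 -> (0 < m)%N ->
  (forall i, (i0 <= i)%N -> exists rho : nat -> R, [/\ forall l, rho l <= q x i l,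
    1 - e <= \sum_(l < width i) rho l &
    forall l, rho l * (Num.max 0 (alpha - e) * (m%:R * ln b%:R)) <= cond_ent x i m l]) ->
  H x k <= (alpha + e) * (k%:R * ln b%:R) ->
  eps * \sum_(1 <= i < k.+1) (1 - m_x b gamma phi x [set y | m%:R^-1 * Hcond b (m_x b gamma phi x) y i m < alpha + eps])
  <= k%:R * (2%:R * e + e * alpha) + m%:R + i0%:R * alpha.
Proof.
move=> eps0 /andP[e0 e1] m0 hrho hk; have al0 := alpha_ge0.
set A := Num.max 0 (alpha - e) in hrho *.
have A0 : 0 <= A by rewrite le_max lexx.
have Aa : A <= alpha by rewrite ge_max al0 /=; lra.
have aA : alpha - e <= A by rewrite le_max lexx orbT.
have mR : 0 < m%:R :> R by rewrite ltr0n.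
set t := m%:R * ln b%:R in hrho *.
have t0 : 0 < t by rewrite mulr_gt0 // lnb0.
pose isbad i l := ~~ (m%:R^-1 * cond_ent_logb x i m l < alpha + eps).
pose bad i := \sum_(l < width i | isbad i l) q x i l.
have badE i : 1 - m_x b gamma phi x [set y | m%:R^-1 * Hcond b (m_x b gamma phi x) y i m < alpha + eps] = bad i.
  rewrite m_xE (_ : pr _ = pr [set w | ~~ isbad i (idx i (Sw x w))]); last first.
    by apply: pr_ext => w _ /=; rewrite /isbad negbK Hcond_idx //; exact: S_bound.
  rewrite (sum_q_pred x i (fun l => ~~ isbad i l)) -(sum_q x i).
  by rewrite [X in X - _](bigID (fun l : 'I__ => isbad i l)) /= addrK.
have badl i l : isbad i l -> q x i l * ((alpha + eps) * t) <= cond_ent x i m l.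
  rewrite /isbad -leNgt => h; rewrite -cond_ent_logbE -mulrA ler_wpM2l ?q_ge0 //.
  rewrite /t mulrA ler_pM2r ?lnb0 //; rewrite ler_pdivlMl // in h.
  by rewrite mulrC.
(* On a bad atom [cond_ent] is at least [q * (alpha + eps) * t], while
   [rho * A * t <= q * alpha * t]. Below [i0] the weights are taken to be 0. *)
have step i : eps * bad i * t <= (H x (i + m) - H x i) - (if (i0 <= i)%N then (1 - e) * A * t else 0).
  have [rho [h1 h2 h3]] : exists rho : nat -> R, [/\ forall l, rho l <= q x i l,
     (if (i0 <= i)%N then (1 - e) * A * t else 0) <= (\sum_(l < width i) rho l) * (A * t) &
     forall l, rho l * (A * t) <= cond_ent x i m l].
    case: leqP => [/hrho [rho [h1 h2 h3]]|_].
      by exists rho; split => //; rewrite -mulrA ler_wpM2r // mulr_ge0 // ltW.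
    exists (fun => 0); split => [l||l]; first exact: q_ge0.
      by rewrite big1 // mul0r.
    by rewrite mul0r cond_ent_ge0.
  rewrite -sum_cond_ent; apply: le_trans (lerB (lexx _) h2).
  rewrite mulr_suml -sumrB /bad mulr_sumr mulr_suml.
  rewrite [leRHS](bigID (fun l : 'I__ => isbad i l)) /= -[leLHS]addr0; apply: lerD.
    apply: ler_sum => l hl; have := badl i l hl.
    have At : 0 <= A * t by rewrite mulr_ge0 // ltW.
    have := ler_wpM2r At (h1 l).
    have : q x i l * (A * t) <= q x i l * (alpha * t) by rewrite ler_wpM2l ?q_ge0 // ler_pM2r.
    lra.
  by apply: sumr_ge0 => l _; rewrite subr_ge0.
under eq_bigr => i _ do rewrite badE.
have hs : eps * (\sum_(1 <= i < k.+1) bad i) * t <=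
    m%:R * (H x k + m%:R * ln b%:R) - (k%:R - i0%:R) * ((1 - e) * A * t).
  rewrite mulr_sumr mulr_suml.
  apply: le_trans (ler_sum _ (fun i _ => step i)) _; rewrite sumrB.
  apply: lerB; first exact: sum_H_shift.
  have c0 : 0 <= (1 - e) * A * t by rewrite mulr_ge0 ?(ltW t0) // mulr_ge0 // subr_ge0.
  move: c0; set c := (1 - e) * A * t => c0.
  elim: (k) => [|k' IH]; first by rewrite big_geq // sub0r mulNr oppr_le0 mulr_ge0.
  rewrite big_nat_recr //= -natr1; case: leqP => hi; first by lra.
  have : k'%:R + 1 <= i0%:R :> R by rewrite natr1 ler_nat ltnW.
  have s0 : 0 <= \sum_(1 <= i < k'.+1) (if (i0 <= i)%N then c else 0).
    by apply: sumr_ge0 => i _; case: ifP.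
  move=> h; apply: (@le_trans _ _ 0); last by rewrite addr0.
  by rewrite mulr_le0_ge0 //; lra.
have hs2 : eps * (\sum_(1 <= i < k.+1) bad i) * t <=
   (k%:R * (alpha + e) + m%:R - (k%:R - i0%:R) * ((1 - e) * A)) * t.
  apply: le_trans hs _.
  have := ler_wpM2l (ltW mR) hk; rewrite /t; lra.
rewrite (ler_pM2r t0) in hs2; apply: le_trans hs2 _.
have w1 : (1 - e) * A <= alpha.
  by apply: le_trans Aa; rewrite ler_piMl //; lra.
have w2 : alpha - e - e * alpha <= (1 - e) * A.
  have : e * A <= e * alpha by rewrite ler_pM2l.
  lra.
have := ler_wpM2l (ler0n R k) w2; have := ler_wpM2l (ler0n R i0) w1; lra.
Qed.

Lemma porous_of_entropy (eps : R) : 0 < eps -> exists2 e : R, 0 < e <= eps / 2%:R &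
  exists M1, forall m, (M1 <= m)%N -> exists K1, forall k, (K1 <= k)%N ->
  forall x, 0 <= x <= 1 -> H x k <= (alpha + e) * (k%:R * ln b%:R) ->
  entropy_porous b (m_x b gamma phi x) alpha eps m 1 k.
Proof.
move=> eps0; have al0 := alpha_ge0.
have z0 : 0 < 4%:R * (2%:R + alpha) by rewrite mulr_gt0 // ltr_wpDr.
(* The last term makes the error [k * (2 * e + e * alpha)] at most [k * eps ^ 2 / 4]; [k] is then
   taken so large that [m + i0 * alpha] is at most as much. So [eps] times the total bad mass is
   below [k * eps ^ 2]. *)
pose e := Num.min (Num.min 1 (eps / 2%:R)) (eps ^+ 2 / (4%:R * (2%:R + alpha))).
have e0 : 0 < e by rewrite /e !lt_min ltr01 !divr_gt0 // exprn_gt0.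
have e1 : e <= 1 by rewrite /e !ge_min lexx.
have e2 : e <= eps / 2%:R by rewrite /e !ge_min lexx orbT.
have e3 : e * (4%:R * (2%:R + alpha)) <= eps ^+ 2.
  by rewrite -ler_pdivlMr // /e !ge_min lexx !orbT.
exists e; first by rewrite e0.
have [M hM] := cond_ent_mostly_large e0.
exists (maxn M 1) => m; rewrite geq_max => /andP[/hM [i0 hi0] m0].
have q0 : 0 < eps ^+ 2 / 4%:R by rewrite divr_gt0 // exprn_gt0.
have W0 : 0 <= (m%:R + i0%:R * alpha) / (eps ^+ 2 / 4%:R).
  by rewrite divr_ge0 ?(ltW q0) // addr_ge0 // mulr_ge0.
exists (maxn 1 (Num.bound ((m%:R + i0%:R * alpha) / (eps ^+ 2 / 4%:R)))) => k.
rewrite geq_max => /andP[k1 hk] x x01 hH.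
have kR : 0 < k%:R :> R by rewrite ltr0n.
have hk' : m%:R + i0%:R * alpha <= k%:R * (eps ^+ 2 / 4%:R).
  rewrite -ler_pdivrMr //; apply: le_trans (ltW (archi_boundP W0)) _.
  by rewrite ler_nat.
have e01 : 0 < e <= 1 by rewrite e0.
have := porous_deficit eps0 e01 m0 (fun i ii0 => hi0 i ii0 x x01) hH.
rewrite /entropy_porous subnK // sumrB sumr_const_nat subSS subn0.
set S := \sum_(1 <= i < k.+1) _ => h.
rewrite mulrC ltr_pdivlMr //.
have h2 : k%:R * (e * (4%:R * (2%:R + alpha))) <= k%:R * eps ^+ 2 by rewrite ler_pM2l.
have h3 : 0 < k%:R * eps ^+ 2 by rewrite mulr_gt0 // exprn_gt0.
rewrite -(ltr_pM2l eps0); rewrite -[1 *+ k]/(k%:R) in h; move: h h2 h3 hk'; rewrite expr2; lra.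
Qed.

(** * Words as grid points *)

Lemma digit_sum_inj n (f g : 'I_n -> nat) : (forall k, f k < b)%N -> (forall k, g k < b)%N ->
  (\sum_(k < n) f k * b ^ k = \sum_(k < n) g k * b ^ k)%N -> forall k, f k = g k.
Proof.
have b0 : (0 < b)%N by rewrite (leq_trans _ b2).
elim: n f g => [|n IH] f g fb gb; first by move=> _ [].
have tail (h : 'I_n.+1 -> nat) :
    (\sum_(k < n.+1) h k * b ^ k = (\sum_(k < n) h (lift ord0 k) * b ^ k) * b + h ord0)%N.
  rewrite big_ord_recl expn0 muln1 addnC big_distrl /=; congr (_ + _)%N.
  by apply: eq_bigr => k _; rewrite /bump add1n expnSr mulnA.
rewrite !tail => e k.
have e0 : f ord0 = g ord0.
  by move/(congr1 (modn^~ b)): e; rewrite /= !modnMDl !modn_small.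
have {}e : (\sum_(k < n) f (lift ord0 k) * b ^ k = \sum_(k < n) g (lift ord0 k) * b ^ k)%N.
  move/eqP: e; rewrite e0 eqn_add2r eqn_pmul2r // => /eqP; exact.
case: (unliftP ord0 k) => [j ->|-> //].
by apply: (IH (fun j => f (lift ord0 j)) (fun j => g (lift ord0 j))).
Qed.

Lemma digit_sum_lt n (f : 'I_n -> nat) : (forall k, f k < b)%N -> (\sum_(k < n) f k * b ^ k < b ^ n)%N.
Proof.
elim: n f => [|n IH] f fb; first by rewrite big_ord0 expn0.
rewrite big_ord_recr /= expnS.
have h := IH (fun k => f (widen_ord (leqnSn n) k)) (fun k => fb _).
have : (f ord_max * b ^ n + b ^ n <= b * b ^ n)%N by rewrite -mulSnr leq_mul2r fb orbT.
by apply: leq_trans; rewrite addnC -addnS leq_add2l.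
Qed.

(** A word codes an integer [t < b ^ n] with [i(0) = t / b ^ n], so [grid_entropy] at entropy scale
    [k], grid level [n] and [x = 0] bounds the share of words failing the entropy bound by
    [e <= eps / 2]; all other words are porous. *)
Lemma porous_words (eps : R) : 0 < eps ->
  exists M1 : nat, forall m : nat, (M1 <= m)%N ->
  exists K1 : nat, forall k : nat, (K1 <= k)%N ->
  exists N1 : nat, forall n : nat, (N1 <= n)%N ->
    @nu_n R b n (fun i : {ffun 'I_n -> 'I_b} =>
       entropy_porous b (m_x b gamma phi (ipt i (0:R))) alpha eps m 1 k) > 1 - eps.
Proof.
move=> eps0; have [e /andP[e0 e2] [M1 hM]] := porous_of_entropy eps0.
have [m0 hm0] := grid_entropy e0.
exists M1 => m /hM [K1 hK]; exists (maxn K1 m0) => k; rewrite geq_max => /andP[/hK hk /hm0 [p0 hp]].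
exists p0 => n /hp /(_ 0); rewrite lexx ler01 => /(_ isT).
set dev := [set t | _]%SET => hdev.
have bX := bXpos n.
pose P (i : {ffun 'I_n -> 'I_b}) := entropy_porous b (m_x b gamma phi (ipt i (0:R))) alpha eps m 1 k.
pose enc (i : {ffun 'I_n -> 'I_b}) : 'I_(b ^ n) :=
  Ordinal (digit_sum_lt (f := fun j => i j : nat) (fun j => ltn_ord (i j))).
have enc_inj : injective enc.
  move=> i j /(congr1 val) /= h; apply/ffunP => l; apply: val_inj => /=.
  by apply: (digit_sum_inj _ _ h) => ?; exact: ltn_ord.
have good i : enc i \notin dev -> P i.
  rewrite inE /deviates -leNgt => h; apply: hk.
    rewrite /ipt add0r divr_ge0 ?(ltW bX) //= ler_pdivrMr // mul1r -natrX ler_nat ltnW //.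
    exact: (ltn_ord (enc i)).
  by move: h; rewrite ler_norml /ipt => /andP[_ h]; move: h; rewrite /=; lra.
rewrite /nu_n -[X in X < _](_ : (1 - eps) * b%:R ^+ n / b%:R ^+ n = _); last by rewrite mulfK ?gt_eqF.
rewrite natrX ltr_pM2r ?invr_gt0 //.
pose bads := [set i | ~~ `[< P i >]]%SET.
have cb : (#|bads| <= #|dev|)%N.
  rewrite -(card_imset _ enc_inj); apply: subset_leq_card; apply/fintype.subsetP => t /imsetP[i].
  rewrite inE => hi ->; apply/negPn/negP => /good Pi; move/negP: hi; apply; exact/asboolP.
have ct : (#|[set i | `[< P i >]]%SET| + #|bads| = b ^ n)%N.
  rewrite (_ : bads = ~: [set i | `[< P i >]]%SET); last by apply/setP => i; rewrite !inE.
  by rewrite cardsC card_ffun !card_ord.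
rewrite (_ : #|_| = #|[set i | `[< P i >]]%SET|); last first.
  apply: eq_card => i; rewrite [RHS]finset.in_set.
  by apply/idP/idP => [/set_mem|h]; last exact: mem_set.
have := ler_nat R #|bads| #|dev|; rewrite cb => cbR.
have : #|[set i | `[< P i >]]%SET|%:R + #|bads|%:R = b%:R ^+ n :> R by rewrite -natrD ct natrX.
have : e * b%:R ^+ n <= eps / 2%:R * b%:R ^+ n by rewrite ler_pM2r.
have : 0 < eps * b%:R ^+ n by rewrite mulr_gt0.
lra.
Qed.

End Discretize.

Theorem theorem5p2 (R : realType) (b : nat) (gamma : R) (phi : R -> R)
  (alpha : R) :
  (2 <= b)%N -> 0 < gamma < 1 ->
  (forall x : R, phi (x + 1) = phi x) ->
  (exists L : R, forall x y : R, `|phi x - phi y| <= L * `|x - y|) ->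
  condH b gamma phi ->
  {ae (@lebesgue_measure R), forall x : R, 0 <= x <= 1 ->
      exact_dimensional (m_x b gamma phi x) alpha} ->
  forall eps : R, 0 < eps ->
  exists M1 : nat, forall m : nat, (M1 <= m)%N ->
  exists K1 : nat, forall k : nat, (K1 <= k)%N ->
  exists N1 : nat, forall n : nat, (N1 <= n)%N ->
    @nu_n R b n (fun i : {ffun 'I_n -> 'I_b} =>
       entropy_porous b (m_x b gamma phi (ipt i (0:R))) alpha eps m 1 k) > 1 - eps.
Proof.
move=> b2 gamma01 per lip _ ae_exact eps eps0.
have [B phi_bound] := lipschitz_periodic_bounded per lip; have [L phi_lip] := lip.
have D_large := le_lt_trans (ler_norm (B / (1 - gamma))) (archi_boundP (normr_ge0 _)).
exact: (porous_words b2 gamma01 phi_bound phi_lip D_large ae_exact eps0).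
Qed.
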